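(* Let $X,U$ be Banach spaces, let $A$ generate a $C_0$-semigroup $(T(t))_{t\ge 0}$ on $X$, and let $B:U\to X_{-1}$ be linear and bounded. If $1\le p<\infty$, then the following are equivalent. (i) $\Sigma(A,B)$ is $L^p$-ISS. (ii) $\Sigma(A,B)$ is $L^p$-iISS. (iii) $\Sigma(A,B)$ is $L^p$-UBEBS and $(T(t))_{t\ge 0}$ is exponentially stable.
   Context: System. $X_{-1}$ is the completion of $X$ with respect to $\|x\|_{X_{-1}}=\|(\beta-A)^{-1}x\|_X$ for some $\beta\in\rho(A)$; $(T(t))_{t\ge0}$ extends uniquely to a $C_0$-semigroup $(T_{-1}(t))_{t\ge0}$ on $X_{-1}$, whose generator $A_{-1}$ extends $A$. $\Sigma(A,B)$ denotes the system $\dot x(t)=Ax(t)+Bu(t)$, $x(0)=x_0$, $t\ge 0$. Its mild solution for $x_0\in X$ and input $u$ is $x(t)=T(t)x_0+\int_0^tT_{-1}(t-s)Bu(s)\,ds$, which in general is an element of $X_{-1}$. $\|\cdot\|$ without index is the norm of $X$. The semigroup is exponentially stable if there are $M,\omega>0$ with $\|T(t)\|\le Me^{-\omega t}$ for all $t\ge0$. Comparison functions ($\mathbb R_0^+=[0,\infty)$). $\mathcal K$: functions $\mu:\mathbb R_0^+\to\mathbb R_0^+$ that are continuous, strictly increasing, with $\mu(0)=0$. $\mathcal K_\infty$: $\theta\in\mathcal K$ with $\lim_{x\to\infty}\theta(x)=\infty$. $\mathcal L$: continuous strictly decreasing $\gamma:\mathbb R_0^+\to\mathbb R_0^+$ with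 $\lim_{t\to\infty}\gamma(t)=0$. $\mathcal{KL}$: $\beta:(\mathbb R_0^+)^2\to\mathbb R_0^+$ with $\beta(\cdot,t)\in\mathcal K$ for all $t\ge0$ and $\beta(s,\cdot)\in\mathcal L$ for all $s>0$. Stability notions. In each of the following, the stated property is to hold for every $t\ge0$, $x_0\in X$, $u\in L^p(0,t;U)$. - $L^p$-ISS: there are $\beta\in\mathcal{KL}$, $\mu\in\mathcal K_\infty$ such that $x(t)\in X$ and $\|x(t)\|\le\beta(\|x_0\|,t)+\mu(\|u\|_{L^p(0,t;U)})$. - $L^p$-iISS: there are $\beta\in\mathcal{KL}$, $\theta\in\mathcal K_\infty$, $\mu\in\mathcal K$ such that $x(t)\in X$ and $\|x(t)\|\le\beta(\|x_0\|,t)+\theta\left(\int_0^t\mu(\|u(s)\|_U)\,ds\right)$. - $L^p$-UBEBS: there are $\gamma,\theta\in\mathcal K_\infty$, $\mu\in\mathcal K$, $c>0$ such that $x(t)\in X$ and $\|x(t)\|\le\gamma(\|x_0\|)+\theta\left(\int_0^t\mu(\|u(s)\|_U)\,ds\right)+c$. If the integral is infinite, the inequality is regarded as trivially satisfied. *)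

(* Defs.v *)
From HB Require Import structures.
From mathcomp Require Import all_boot all_order all_algebra.
From mathcomp Require Import complex.
From mathcomp Require Import all_classical all_reals all_analysis.
Set Implicit Arguments.
Unset Strict Implicit.
Unset Printing Implicit Defensive.
Import Order.TTheory GRing.Theory Num.Theory.
Import numFieldNormedType.Exports.
Local Open Scope classical_set_scope.
Local Open Scope ring_scope.

(* [scalars R K] says that the real elements of the scalar field K are exactly
   the real numbers R.  By the Gelfand-Mazur theorem K is then the real or the
   complex field, see [real_scalars] and [complex_scalars]; this lets one
   statement cover both real and complex Banach spaces.  Norms in a
   [normedModType K] are nonnegative elements of K, which [toR] reads in R. *)
Record scalars (R : realType) (K : numFieldType) := Scalars {
  ofR : {rmorphism R -> K};
  toR : K -> R;
  ofR_le : {mono ofR : x y / x <= y};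
  toRK : {in Num.real, cancel toR ofR} }.

Definition real_scalars (R : realType) : scalars R R :=
  @Scalars R R idfun id (fun _ _ => erefl) (fun _ _ => erefl).

Definition complex_scalars (R : realType) : scalars R (R[i])%C :=
  @Scalars R (R[i])%C (real_complex R) (@complex.Re R)
    (@lecR R) (@RRe_real R).

Section Comparison.
Context {R : realType}.

Definition class_K (f : R -> R) : Prop :=
  [/\ {within `[0, +oo[%classic, continuous f},
      forall x y, 0 <= x -> x < y -> f x < f y,
      f 0 = 0
    & forall x, 0 <= x -> 0 <= f x].

Definition class_Koo (f : R -> R) : Prop :=
  class_K f /\ f x @[x --> +oo] --> +oo.

Definition class_L (f : R -> R) : Prop :=
  [/\ {within `[0, +oo[%classic, continuous f},
      forall x y, 0 <= x -> x < y -> f y < f x,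
      f x @[x --> +oo] --> 0
    & forall x, 0 <= x -> 0 <= f x].

Definition class_KL (b : R -> R -> R) : Prop :=
  (forall t, 0 <= t -> class_K (b ^~ t)) /\
  (forall s, 0 < s -> class_L (b s)).

End Comparison.

Section Norm.
Context {R : realType} {K : numFieldType} (S : scalars R K).

Definition rnorm {E : normedModType K} (x : E) : R := toR S `|x|.

Definition bounded_op {E F : normedModType K} (f : E -> F) : Prop :=
  exists M : R, forall x, rnorm (f x) <= M * rnorm x.

End Norm.

Section Bochner.
Context {R : realType} {K : numFieldType} (S : scalars R K)
        {E : normedModType K}.
Local Notation leb := (@lebesgue_measure R).

Definition simple_on (D : set R) (g : R -> E) : Prop :=
  finite_set (g @` D) /\ forall v, measurable (D `&` g @^-1` [set v]).

Definition simple_integral (D : set R) (g : R -> E) : E :=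
  \sum_(v \in g @` D) ofR S (fine (leb (D `&` g @^-1` [set v]))) *: v.

Definition strongly_measurable (D : set R) (f : R -> E) : Prop :=
  exists g : nat -> R -> E,
    (forall n, simple_on D (g n)) /\
    {ae leb, forall s, D s -> g n s @[n --> \oo] --> f s}.

(* Only used on sets D of finite measure, so that the coefficients of
   [simple_integral] are finite. *)
Definition is_bochner_integral (D : set R) (f : R -> E) (v : E) : Prop :=
  strongly_measurable D f /\
  exists g : nat -> R -> E,
    [/\ forall n, simple_on D (g n),
        (\int[leb]_(s in D) (rnorm S (f s - g n s)%R)%:E)%E @[n --> \oo]
          --> 0%E
      & simple_integral D (g n) @[n --> \oo] --> v].

Definition in_Lp (p t : R) (u : R -> E) : Prop :=
  strongly_measurable `]0, t[%classic u /\
  (\int[leb]_(s in `]0%R, t[) (rnorm S (u s) `^ p)%R%:E < +oo)%E.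

Definition Lp_norm (p t : R) (u : R -> E) : R :=
  fine (\int[leb]_(s in `]0%R, t[) (rnorm S (u s) `^ p)%R%:E)%E `^ p^-1.

End Bochner.

(* An unbounded operator; only the values of [app] on [dom] are meaningful. *)
Record unbounded_op (X : Type) := UnboundedOp {
  dom : set X;
  app :> X -> X }.

Section Semigroup.
Context {R : realType} {K : numFieldType} (S : scalars R K)
        {X : normedModType K}.

Definition C0_semigroup (T : R -> {linear X -> X}) : Prop :=
  [/\ forall t, 0 <= t -> bounded_op S (T t),
      forall x, T 0 x = x,
      forall s t x, 0 <= s -> 0 <= t -> T (s + t) x = T s (T t x)
    & forall x, T h x @[h --> 0^'+] --> x].

Definition generates (A : unbounded_op X) (T : R -> {linear X -> X}) : Prop :=
  C0_semigroup T /\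
  forall x y, (dom A x /\ A x = y) <->
    (ofR S h^-1 *: (T h x - x) @[h --> 0^'+] --> y).

(* Q = (beta - A)^-1 as an everywhere defined bounded operator; in particular
   beta belongs to the resolvent set of A. *)
Definition is_resolvent (A : unbounded_op X) (beta : K)
    (Q : {linear X -> X}) : Prop :=
  [/\ bounded_op S Q,
      forall x, dom A (Q x) /\ beta *: Q x - A (Q x) = x
    & forall x, dom A x -> Q (beta *: x - A x) = x].

Definition exponentially_stable (T : R -> {linear X -> X}) : Prop :=
  exists M w : R, [/\ 0 < M, 0 < w &
    forall t x, 0 <= t -> rnorm S (T t x) <= M * expR (- (w * t)) * rnorm S x].

End Semigroup.

(* The completion of X for |(beta - A)^-1 x| is given by its defining property:
   a Banach space Xm1 with a linear map J : X -> Xm1 of dense range that is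
   isometric for this norm.  J is the inclusion of X in Xm1. *)
Definition is_extrapolation_space {R : realType} {K : numFieldType}
    (S : scalars R K) {X Xm1 : completeNormedModType K}
    (A : unbounded_op X) (J : {linear X -> Xm1}) : Prop :=
  exists (beta : K) (Q : {linear X -> X}),
    [/\ is_resolvent S A beta Q,
        forall x, `|J x| = `|Q x|
      & dense (range J)].

Section System.
Context {R : realType} {K : numFieldType} (S : scalars R K)
        {X U Xm1 : completeNormedModType K}
        (J : {linear X -> Xm1})
        (T : R -> {linear X -> X}) (Tm1 : R -> {linear Xm1 -> Xm1})
        (B : {linear U -> Xm1}).
Local Notation leb := (@lebesgue_measure R).
Local Notation nrm := (rnorm S).

Definition is_extended_semigroup : Prop :=
  C0_semigroup S Tm1 /\ forall t x, 0 <= t -> Tm1 t (J x) = J (T t x).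

Definition is_mild_solution_at (t : R) (x0 : X) (u : R -> U) (z : Xm1) : Prop :=
  exists2 v, is_bochner_integral S `]0, t[%classic
               (fun s => Tm1 (t - s) (B (u s))) v
           & z = J (T t x0) + v.

(* In the three notions below, the witness x with J x = x(t) expresses that
   the mild solution satisfies x(t) \in X. *)
Definition Lp_ISS (p : R) : Prop :=
  exists beta mu, [/\ class_KL beta, class_Koo mu &
    forall t x0 u, 0 <= t -> in_Lp S p t u ->
      exists2 x : X, is_mild_solution_at t x0 u (J x) &
        nrm x <= beta (nrm x0) t + mu (Lp_norm S p t u)].

Definition mu_integral (mu : R -> R) (t : R) (u : R -> U) : \bar R :=
  (\int[leb]_(s in `]0%R, t[) (mu (nrm (u s)))%:E)%E.

Definition Lp_iISS (p : R) : Prop :=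
  exists beta theta mu, [/\ class_KL beta, class_Koo theta, class_K mu &
    forall t x0 u, 0 <= t -> in_Lp S p t u ->
      exists2 x : X, is_mild_solution_at t x0 u (J x) &
        ((mu_integral mu t u < +oo)%E ->
         nrm x <= beta (nrm x0) t + theta (fine (mu_integral mu t u)))].

Definition Lp_UBEBS (p : R) : Prop :=
  exists gamma theta mu c,
    [/\ class_Koo gamma /\ class_Koo theta, class_K mu, 0 < c &
    forall t x0 u, 0 <= t -> in_Lp S p t u ->
      exists2 x : X, is_mild_solution_at t x0 u (J x) &
        ((mu_integral mu t u < +oo)%E ->
         nrm x <= gamma (nrm x0) + theta (fine (mu_integral mu t u)) + c)].

End System.

(* Main.v *)
(**
  Each of the three properties is equivalent to: T is exponentially stable and
  every input in L^p(0,t;U) steers 0 into X at every time t.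

  Zero inputs give |T(t)x| <= beta(1,t) |x|, hence exponential stability, in (i)
  and (ii).  Conversely, let Phi_t u in X be the state reached from 0.  The map
  u |-> |Phi_t u|_X is a countably subadditive seminorm on L^p(0,t;U): partial
  sums that converge absolutely in X have their limit identified in X_{-1}, where
  u |-> Phi_t u is continuous because |T_{-1}(t)| obeys the same exponential
  bound as |T(t)|.  By Zabreiko's lemma it is bounded, that is
  |Phi_t u|_X <= C |u|_p.  To make C independent of t, choose tau with
  |T(tau)| <= 1/2 and use Phi_t u = T(tau) Phi_{t-tau} u + Phi_tau u(. + t - tau).
  Hence |x(t)| <= M e^{-wt} |x_0| + C |u|_p, which implies (i), (ii) and (iii)
  with explicit comparison functions.
*)
Require Import Defs.
From mathcomp Require Import all_boot all_order all_algebra.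
From mathcomp Require Import all_classical all_reals all_analysis.
From mathcomp Require Import measurable_realfun lra.
Set Implicit Arguments.
Unset Strict Implicit.
Unset Printing Implicit Defensive.
Import Order.TTheory GRing.Theory Num.Theory.
Import numFieldNormedType.Exports.
Local Open Scope classical_set_scope.
Local Open Scope ring_scope.

(** * Norms read in the real numbers *)

(** Inputs are functions, not classes modulo null sets, so L^p(0,t;U) appears as the set [in_Lp]
    with a seminorm. The boundedness argument is therefore stated for a seminorm q on a set V closed
    under sums and real multiples, and countable subadditivity of q takes the place of a closed
    graph in a Banach space. Values lie in a possibly nonseparable space. Strong measurability is an
    a.e. limit of simple functions, the norm of such a function is measurable only off a null set,
    and the integral must be shown additive and shift invariant for such norms. Functions on an
    interval are extended by 0 to the line, where shifting an input does not move the domain of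
    integration. Finiteness of p gives the comparison functions: with mu(r) = r^p and theta(r) = C
    r^(1/p), the term theta(integral of mu(|u|)) is C |u|_p itself. *)

Section RealNorm.
Context {R : realType} {K : numFieldType} (S : scalars R K).
Implicit Types E F : normedModType K.

Lemma ofR_rnorm E (x : E) : ofR S (rnorm S x) = `|x|.
Proof. by apply: (toRK S); exact: normr_real. Qed.

Lemma ofR_lt : {mono ofR S : x y / x < y}.
Proof. by move=> x y; rewrite (leW_mono (ofR_le S)). Qed.

Lemma ofR_inj : injective (ofR S).
Proof. by move=> x y e; apply/eqP; rewrite eq_le -!(ofR_le S) e lexx. Qed.

Lemma rnorm_le E F (x : E) (y : F) : (rnorm S x <= rnorm S y) = (`|x| <= `|y|).
Proof. by rewrite -(ofR_le S) !ofR_rnorm. Qed.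

Lemma rnorm_ge0 E (x : E) : 0 <= rnorm S x.
Proof. by rewrite -(ofR_le S) ofR_rnorm rmorph0. Qed.

Lemma rnorm0 E : rnorm S (0 : E) = 0.
Proof. by apply: ofR_inj; rewrite ofR_rnorm normr0 rmorph0. Qed.

Lemma rnorm_eq0 E (x : E) : rnorm S x = 0 -> x = 0.
Proof. by move=> /(congr1 (ofR S)); rewrite ofR_rnorm rmorph0 => /normr0_eq0. Qed.

Lemma rnormD E (x y : E) : rnorm S (x + y) <= rnorm S x + rnorm S y.
Proof. by rewrite -(ofR_le S) rmorphD/= !ofR_rnorm ler_normD. Qed.

Lemma rnormN E (x : E) : rnorm S (- x) = rnorm S x.
Proof. by apply: ofR_inj; rewrite !ofR_rnorm normrN. Qed.

Lemma rnormC E (x y : E) : rnorm S (x - y) = rnorm S (y - x).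
Proof. by rewrite -opprB rnormN. Qed.

Lemma rnormB E (x y : E) : rnorm S (x - y) <= rnorm S x + rnorm S y.
Proof. by rewrite -(rnormN y) rnormD. Qed.

Lemma rnormBD E (z x y : E) : rnorm S (x - y) <= rnorm S (x - z) + rnorm S (z - y).
Proof. by rewrite -{1}(subrK z x) -addrA rnormD. Qed.

Lemma norm_ofR (a : R) : `|ofR S a| = ofR S `|a|.
Proof.
case: (leP 0 a) => a0.
  by rewrite !ger0_norm// -(rmorph0 (ofR S)) (ofR_le S).
by rewrite !ltr0_norm ?rmorphN// -(rmorph0 (ofR S)) ofR_lt.
Qed.

Lemma rnormZ E (a : R) (x : E) : rnorm S (ofR S a *: x) = `|a| * rnorm S x.
Proof. by apply: ofR_inj; rewrite rmorphM/= !ofR_rnorm normrZ norm_ofR. Qed.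

Lemma rnorm_sum E (I : Type) (r : seq I) (P : pred I) (f : I -> E) :
  rnorm S (\sum_(i <- r | P i) f i) <= \sum_(i <- r | P i) rnorm S (f i).
Proof.
elim/big_ind2: _ => [|x a y b xa yb|//]; first by rewrite rnorm0.
by rewrite (le_trans (rnormD _ _))// lerD.
Qed.

Lemma ler_rnorm_dist E (x y : E) : `|rnorm S x - rnorm S y| <= rnorm S (x - y).
Proof.
rewrite ler_norml; apply/andP; split.
  rewrite lerNl opprB lerBlDr rnormC; apply: le_trans (rnormD _ _).
  by rewrite subrK.
by rewrite lerBlDr; apply: le_trans (rnormD _ _); rewrite subrK.
Qed.

(** Radii of balls are positive elements of K, hence real, hence in the image of [ofR]. All later
    limit arguments can thus be carried out in R. *)
Lemma cvg_rnormP E (T : Type) (F : set_system T) {FF : Filter F}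
    (f : T -> E) (l : E) :
  f @ F --> l <-> rnorm S (f x - l) @[x --> F] --> (0 : R).
Proof.
rewrite cvgrPdistC_lt cvgrPdistC_lt; split => h e e0.
  have := h (ofR S e); rewrite -(rmorph0 (ofR S)) ofR_lt => /(_ e0).
  apply: filterS => x; rewrite -ofR_rnorm ofR_lt subr0 ger0_norm//.
  exact: rnorm_ge0.
have eE : ofR S (toR S e) = e by apply: (toRK S); rewrite gtr0_real.
have /h : 0 < toR S e by rewrite -ofR_lt eE rmorph0.
apply: filterS => x; rewrite subr0 ger0_norm ?rnorm_ge0//.
by rewrite -ofR_lt eE ofR_rnorm.
Qed.

Lemma cvg_rnorm E (T : Type) (F : set_system T) {FF : Filter F}
    (f : T -> E) (l : E) :
  f @ F --> l -> rnorm S (f x) @[x --> F] --> rnorm S l.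
Proof.
move=> /cvg_rnormP/cvgrPdistC_lt h; apply/cvgrPdistC_lt => e /h.
apply: filterS => x; rewrite subr0 ger0_norm ?rnorm_ge0//.
exact: le_lt_trans (ler_rnorm_dist _ _).
Qed.

Lemma cauchy_rnorm_cvg (E : completeNormedModType K) (u : nat -> E) :
  (forall e : R, 0 < e ->
     exists n, forall m, (n <= m)%N -> rnorm S (u m - u n) < e) -> cvgn u.
Proof.
move=> h; apply/cauchy_cvgP/cauchy_exP => e e0.
have eE : ofR S (toR S e) = e by apply: (toRK S); rewrite gtr0_real.
have /h[n hn] : 0 < toR S e by rewrite -ofR_lt eE rmorph0.
exists (u n); exists n => // m /= nm.
by rewrite -ball_normE /ball_/= -ofR_rnorm -eE ofR_lt rnormC hn.
Qed.

Lemma cvg_series_rnorm (E : completeNormedModType K) (w : nat -> E) :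
  cvgn (series (fun k => rnorm S (w k))) -> cvgn (series w).
Proof.
move=> /cauchy_cvgP/cauchy_seriesP h; apply: cauchy_rnorm_cvg => e /h.
move=> [[A B] [[a _ hA] [b _ hB]] hAB].
exists (maxn a b) => m abm.
have := hAB (maxn a b, m).
rewrite sub_series abm /= ger0_norm ?sumr_ge0// => [H|i _]; last exact: rnorm_ge0.
apply: le_lt_trans (rnorm_sum _ _ _) (H _); split; [apply: hA|apply: hB] => /=.
  exact: leq_maxl.
by rewrite (leq_trans _ abm)// leq_maxr.
Qed.

Lemma bounded_op_cvg E F (L : {linear E -> F}) (I : Type) (G : set_system I)
    {FG : Filter G} (f : I -> E) (l : E) :
  bounded_op S L -> f @ G --> l -> L (f x) @[x --> G] --> L l.
Proof.
move=> [M hM] /cvg_rnormP h; apply/cvg_rnormP.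
(* [bounded_op] puts no sign on M, hence its absolute value. *)
apply: (squeeze_cvgr (f := cst 0) (h := fun x => `|M| * rnorm S (f x - l))).
- near=> x; rewrite /= rnorm_ge0/= -linearB (le_trans (hM _))//.
  by rewrite ler_wpM2r ?rnorm_ge0// ler_norm.
- exact: cvg_cst.
- by rewrite -[X in _ --> X](mulr0 `|M|); apply: cvgMr.
Unshelve. all: by end_near.
Qed.

End RealNorm.

(** * Countably subadditive seminorms *)

Lemma exp_half_lt (R : realType) (e : R) : 0 < e -> exists n, 2^-1 ^+ n < e.
Proof.
move=> e0; have : (2^-1 : R) ^+ n @[n --> \oo] --> 0.
  by apply: cvg_expr; rewrite ger0_norm ?invr_ge0// invf_lt1// ltr1n.
move=> /cvgrPdist_lt/(_ e e0)[n _ /(_ n (leqnn n))].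
by rewrite sub0r normrN ger0_norm ?exprn_ge0 ?invr_ge0//; exists n.
Qed.

Section Zabreiko.
Context {R : realType} {K : numFieldType} (S : scalars R K).
Context {W : lmodType K} (V : set W) (N q : W -> R).
Hypothesis V0 : V 0.
Hypothesis VD : forall u w, V u -> V w -> V (u + w).
Hypothesis VZ : forall a u, V u -> V (ofR S a *: u).
Hypothesis ND : forall u w, V u -> V w -> N (u + w) <= N u + N w.
Hypothesis NZ : forall a u, V u -> N (ofR S a *: u) = `|a| * N u.
Hypothesis qD : forall u w, V u -> V w -> q (u + w) <= q u + q w.
Hypothesis qZ : forall a u, V u -> q (ofR S a *: u) = `|a| * q u.
(** Completeness in the only form used: series with terms of size 2^-k converge. The bound is the
    tail of the geometric series from n on. *)
Hypothesis N_complete : forall w : nat -> W,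
  (forall k, V (w k) /\ N (w k) <= 2^-1 ^+ k) ->
  exists2 s, V s & forall n, N (s - series w n) <= 2 * 2^-1 ^+ n.
(** Countable subadditivity, phrased through bounded partial sums so that no infinite sum of values
    of q has to be formed. *)
Hypothesis q_sigma : forall u (w : nat -> W) (c : R), V u -> (forall k, V (w k)) ->
  N (u - series w n) @[n --> \oo] --> (0 : R) ->
  (forall n, series (q \o w) n <= c) -> q u <= c.

Let VN u : V u -> V (- u).
Proof. by move=> /(@VZ (-1)); rewrite rmorphN1 scaleN1r. Qed.

Let VB u w : V u -> V w -> V (u - w).
Proof. by move=> Vu /VN; exact: VD. Qed.

Let NN u : V u -> N (- u) = N u.
Proof. by move=> /(@NZ (-1)); rewrite rmorphN1 scaleN1r normrN1 mul1r. Qed.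

Let qN u : V u -> q (- u) = q u.
Proof. by move=> /(@qZ (-1)); rewrite rmorphN1 scaleN1r normrN1 mul1r. Qed.

Let NBC u w : V u -> V w -> N (u - w) = N (w - u).
Proof. by move=> Vu Vw; rewrite -NN ?opprB//; exact: VB. Qed.

Let NBD z u w : V z -> V u -> V w -> N (u - w) <= N (u - z) + N (z - w).
Proof. by move=> Vz Vu Vw; rewrite -{1}(subrK z u) -addrA ND//; exact: VB. Qed.

Let N0 : N 0 = 0.
Proof. by have := NZ 0 V0; rewrite rmorph0 scale0r normr0 mul0r. Qed.

Let N_ge0 u : V u -> 0 <= N u.
Proof. by move=> Vu; have := ND Vu (VN Vu); rewrite subrr N0 NN//; lra. Qed.

Let q_ge0 u : V u -> 0 <= q u.
Proof.
move=> Vu; have := qD Vu (VN Vu); rewrite subrr qN//.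
by have := qZ 0 V0; rewrite rmorph0 scale0r normr0 mul0r => ->; lra.
Qed.

(* Baire's argument: otherwise one could choose a shrinking sequence of balls,
   the n-th of which avoids the set [q <= n], and q would be infinite at the
   common point of these balls. *)
Lemma sublevel_somewhere_dense : exists n u r, [/\ 0 < r, V u &
  forall w, V w -> N (w - u) < r -> forall e, 0 < e ->
    exists w', [/\ V w', q w' <= n%:R & N (w - w') < e]].
Proof.
apply: contrapT => nd.
have step n (st : W * R) : exists st' : W * R, V st.1 -> 0 < st.2 ->
    [/\ V st'.1, N (st'.1 - st.1) < st.2, 0 < st'.2, st'.2 <= st.2 / 2 &
      forall w', V w' -> q w' <= n%:R -> 4 * st'.2 <= N (st'.1 - w')].
  have [[Vu r0]|h] := pselect (V st.1 /\ 0 < st.2); last first.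
    by exists st => Vu r0; exfalso; apply: h.
  apply: contrapT => nst; apply: nd; exists n, st.1, st.2; split => // w Vw wr e e0.
  (* No point of the sublevel set lies within e of the new centre w. The radius is at most e/4
     because the limit of the centres will be located only up to 4 radii; halving makes the radii
     summable. *)
  apply: contrapT => ne; apply: nst; exists (w, Num.min (e / 4) (st.2 / 2)) => _ _.
  split => //=; first by rewrite lt_min; apply/andP; split; lra.
    by rewrite ge_min lexx orbT.
  move=> w' Vw' qw'; rewrite leNgt; apply/negP => h; apply: ne; exists w'.
  split => //; have : Num.min (e / 4) (st.2 / 2) <= e / 4 by rewrite ge_min lexx.
  by lra.
have [F hF] := choice (fun p : nat * (W * R) => step p.1 p.2).
pose s := fix s n := if n is m.+1 then F (m, s m) else (0, 1) : W * R.
have inv n : [/\ V (s n).1, 0 < (s n).2 & (s n).2 <= 2^-1 ^+ n].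
  elim: n => [|n [Vs s0 sn]]; first by split => //=; rewrite expr0.
  have [/= V' _ r0 r2 _] := hF (n, s n) Vs s0; split => //.
  by rewrite exprS; lra.
have stepS n : N ((s n.+1).1 - (s n).1) < (s n).2 /\ (s n.+1).2 <= (s n).2 / 2.
  by have [Vs s0 _] := inv n; have [/= _ ? _ ? _] := hF (n, s n) Vs s0.
pose w k := (s k.+1).1 - (s k).1.
have [|t Vt tP] := N_complete (w := w).
  move=> k; have [Vs s0 sk] := inv k; have [Vs' _ _] := inv k.+1.
  by split; [exact: VB|have [? _] := stepS k; rewrite /w; lra].
have serw n : series w n = (s n).1.
  by rewrite /series/= telescope_sumr// subr0.
set n := Num.bound (q t); have qtn : q t <= n%:R.
  by rewrite ltW// archi_boundP// q_ge0.
have [Vn rn0 _] := inv n; have [/= Vm _ rm _ far] := hF (n, s n) Vn rn0.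
have {far} := far t Vt qtn; rewrite -/(s n.+1); set m := n.+1 => far.
(* Since the radii halve, later centres stay within two radii of the m-th one; the term with the
   later radius makes the induction close. *)
have dist j : N ((s (m + j)%N).1 - (s m).1) + 2 * (s (m + j)%N).2 <= 2 * (s m).2.
  elim: j => [|j IH]; first by rewrite addn0 subrr N0 add0r.
  rewrite addnS; have [h1 h2] := stepS (m + j)%N.
  have [Vj _ _] := inv (m + j)%N; have [Vj' _ _] := inv (m + j).+1.
  by have := NBD Vj Vj' Vm; rewrite -/m -/(s m); lra.
(* For this j the limit is less than two radii away from the centre number m + j, hence less than
   four from the m-th, against [far]. *)
have [j hj] := exp_half_lt rm.
have [Vj rj0 _] := inv (m + j)%N.
have := tP (m + j)%N; rewrite serw => h1.
have h2 : (2^-1 : R) ^+ (m + j) <= 2^-1 ^+ j.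
  by rewrite ler_wiXn2l ?invr_ge0 ?invf_le1 ?ler1n ?leq_addl.
have := dist j; have := NBD Vj Vm Vt; rewrite (NBC Vm Vj) (NBC Vj Vt) -/(s m).
have hj' : 2^-1 ^+ j < (s m).2 by exact: hj.
by lra.
Qed.

(** Density of a sublevel set in one ball is moved to balls around 0 by taking differences, and to
    all radii by scaling. Successive approximation then writes u as a series along which q decays
    geometrically. *)
Lemma zabreiko : exists2 C, 0 <= C & forall u, V u -> q u <= C * N u.
Proof.
have [n [u0 [r [r0 Vu0 dns]]]] := sublevel_somewhere_dense.
have dns0 w e : V w -> N w < r -> 0 < e ->
    exists w', [/\ V w', q w' <= 2 * n%:R & N (w - w') < e].
  move=> Vw wr e0; have e20 : 0 < e / 2 by lra.
  have [|w1 [V1 q1 N1]] := dns (w + u0) (VD Vw Vu0) _ _ e20; first by rewrite addrK.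
  have [|w2 [V2 q2 N2]] := dns u0 Vu0 _ _ e20; first by rewrite subrr N0.
  exists (w1 - w2); split; first exact: VB.
    by have := qD V1 (VN V2); rewrite qN//; lra.
  have -> : w - (w1 - w2) = (w + u0 - w1) - (u0 - w2).
    by rewrite !opprB [w2 - u0]addrC [RHS]addrA [_ - w1 - u0]addrAC addrK [RHS]addrAC addrA.
  have := ND (VB (VD Vw Vu0) V1) (VN (VB Vu0 V2)).
  by rewrite NN ?opprB; [lra|exact: VB].
(* Differences have level 2n on radius r; scaling by s / r turns this into level D s on radius s. *)
pose D := 2 * n%:R / r.
have D0 : 0 <= D by rewrite /D divr_ge0 ?mulr_ge0// ltW.
have dnsZ w s e : V w -> N w < s -> 0 < e ->
    exists w', [/\ V w', q w' <= D * s & N (w - w') < e].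
  move=> Vw ws e0; have s0 : 0 < s := le_lt_trans (N_ge0 Vw) ws.
  have rs : 0 < r / s by rewrite divr_gt0.
  have sr : 0 < s / r by rewrite divr_gt0.
  have [||w' [Vw' qw' Nw']] := @dns0 (ofR S (r / s) *: w) (r / s * e) (VZ _ Vw).
  - by rewrite NZ// ger0_norm ?ltW// mulrAC ltr_pdivrMr// ltr_pM2l.
  - exact: mulr_gt0.
  exists (ofR S (s / r) *: w'); split; first exact: VZ.
    rewrite qZ// (ger0_norm (ltW sr)); apply: le_trans (ler_wpM2l (ltW sr) qw') _.
    by rewrite /D [leRHS]mulrC -!mulrA [_^-1 * _]mulrC !mulrA.
  rewrite -(ltr_pM2l rs) -[r / s as X in X * N _](ger0_norm (ltW rs)).
  rewrite -NZ; last exact: VB (VZ _ Vw').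
  rewrite scalerBr scalerA -rmorphM/=.
  by rewrite (_ : r / s * (s / r) = 1) ?rmorph1 ?scale1r// mulrA divfK ?divff// gt_eqF.
clearbody D; have D20 : 0 < 2 * D + 1 by rewrite ltr_wpDl// mulr_ge0.
exists (2 * D) => [|u Vu]; first by rewrite mulr_ge0.
(* Density is available only under a strict bound, and N u may be 0 for nonzero u, so s > N u is
   used and then brought down to N u. *)
suff main s : N u < s -> q u <= 2 * D * s.
  apply/ler_addgt0Pr => e e0; have De : 0 < e / (2 * D + 1).
    by rewrite divr_gt0.
  have := main (N u + e / (2 * D + 1)); rewrite ltrDl => /(_ De) /le_trans; apply.
  rewrite mulrDr lerD2l mulrA ler_pdivrMr//.
  by rewrite mulrC ler_pM2l// lerDl ler01.
move=> us; have s0 : 0 < s := le_lt_trans (N_ge0 Vu) us.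
have step k (w : W) : exists w', V w -> N w < s * 2^-1 ^+ k ->
    [/\ V w', q w' <= D * (s * 2^-1 ^+ k) & N (w - w') < s * 2^-1 ^+ k.+1].
  have [[Vw ws]|h] := pselect (V w /\ N w < s * 2^-1 ^+ k); last first.
    by exists w => Vw ws; exfalso; apply: h.
  have [|w' h] := @dnsZ w (s * 2^-1 ^+ k) (s * 2^-1 ^+ k.+1) Vw ws.
    by rewrite mulr_gt0// exprn_gt0// invr_gt0.
  by exists w'.
have [F hF] := choice (fun p : nat * W => step p.1 p.2).
(* [x k] is what remains of u after k approximations, and [w k] is the next approximation. *)
pose x := fix x k := if k is m.+1 then x m - F (m, x m) else u.
pose w k := F (k, x k).
have inv k : V (x k) /\ N (x k) < s * 2^-1 ^+ k.
  elim: k => [|k [Vx Nx]]; first by rewrite /= mulr1.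
  by have [/= V' _ N'] := hF (k, x k) Vx Nx; split => //; exact: VB.
have Vw k : V (w k) by have [Vx Nx] := inv k; have [] := hF (k, x k) Vx Nx.
have xE k : x k = u - series w k.
  elim: k => [|k IH]; first by rewrite /series/= big_geq// subr0.
  by rewrite seriesSr opprD addrA -IH.
apply: (q_sigma (w := w)) => //.
  apply: (squeeze_cvgr (f := cst 0) (h := fun n => s * 2^-1 ^+ n)).
  - by near=> k; rewrite /= -xE; have [Vx /ltW ->] := inv k; rewrite N_ge0.
  - exact: cvg_cst.
  - rewrite -[X in _ --> X](mulr0 s); apply: cvgMr; apply: cvg_expr.
    by rewrite ger0_norm ?invr_ge0// invf_lt1// ltr1n.
(* The factor 1 - 2^-m is the partial geometric sum, which makes the induction exact. *)
move=> m; suff : series (q \o w) m <= 2 * D * s * (1 - 2^-1 ^+ m).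
  move=> /le_trans; apply; apply: ler_piMr; first by rewrite !mulr_ge0// ltW.
  by rewrite lerBlDr lerDl exprn_ge0// invr_ge0.
elim: m => [|m IH]; first by rewrite /series/= big_geq// expr0 subrr mulr0.
rewrite seriesSr /= exprS.
have [Vx Nx] := inv m; have [/= _ qw _] := hF (m, x m) Vx Nx.
by rewrite /w; nra.
Unshelve. all: by end_near.
Qed.

End Zabreiko.

(** * Lebesgue integrals of almost everywhere measurable functions *)

Section LowerIntegral.
Import HBNNSimple.
Context {d : measure_display} {T : measurableType d} {R : realType}.
Variable mu : {measure set T -> \bar R}.
Implicit Types f g : T -> R.

(** The norm of an a.e. limit of simple functions is of this kind; it need not be measurable
    itself. *)
Definition ae_measurable f : Prop := exists2 f' : T -> R,
  measurable_fun setT f' & {ae mu, forall x, f x = f' x}.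

(* The Lebesgue integral of a nonnegative function is defined as a supremum over
   simple functions; it ignores null sets even if the functions are not
   measurable. *)
Lemma ge0_ae_le_integral f g : (forall x, 0 <= f x) -> (forall x, 0 <= g x) ->
  {ae mu, forall x, f x <= g x} ->
  (\int[mu]_x (f x)%:E <= \int[mu]_x (g x)%:E)%E.
Proof.
move=> f0 g0 [N [mN N0 fgN]].
rewrite ge0_integralE => [|x _]; last by rewrite lee_fin.
apply: ge_ereal_sup => _ [h hf <-].
have mNC : measurable (~` N) by exact: measurableC.
(* Cutting h off on the null set N keeps its integral and puts it below g everywhere, so it competes
   in the supremum defining the integral of g. *)
pose h' := proj_nnsfun h mNC.
have -> : sintegral mu h = sintegral mu h'.
  rewrite -!integralT_nnsfun; apply: ge0_ae_eq_integral => //.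
  - exact/measurable_EFinP.
  - exact/measurable_EFinP.
  - by move=> x _; rewrite lee_fin.
  - by move=> x _; rewrite lee_fin.
  - exists N; split => // x /=; apply: contra_notP => Nx _.
    by rewrite /= mindicE mem_set// mulr1.
rewrite ge0_integralE => [|x _]; last by rewrite lee_fin.
apply: ereal_sup_ubound; exists h' => //= x; rewrite patchT ?inE// lee_fin mindicE.
have [Nx|Nx] := pselect (N x); first by rewrite memNset ?mulr0// => /(_ Nx).
rewrite mem_set// mulr1; have fg : f x <= g x.
  by apply: contrapT => h1; exact/Nx/fgN.
by apply: le_trans fg; have := hf x; rewrite patchT ?inE.
Qed.

Lemma ge0_ae_eq_integral_fin f g : (forall x, 0 <= f x) -> (forall x, 0 <= g x) ->
  {ae mu, forall x, f x = g x} ->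
  (\int[mu]_x (f x)%:E = \int[mu]_x (g x)%:E)%E.
Proof.
move=> f0 g0 fg; apply/eqP; rewrite eq_le !ge0_ae_le_integral//.
  by apply: filterS fg => x ->.
by apply: filterS fg => x ->.
Qed.

Lemma ae_measurable_ge0 f : ae_measurable f -> (forall x, 0 <= f x) ->
  exists f' : T -> R, [/\ measurable_fun setT f', forall x, 0 <= f' x,
    {ae mu, forall x, f x = f' x} &
    (\int[mu]_x (f x)%:E = \int[mu]_x (f' x)%:E)%E].
Proof.
move=> [f' mf' ff'] f0; exists (fun x => Num.max (f' x) 0).
have h : {ae mu, forall x, f x = Num.max (f' x) 0}.
  by apply: filterS ff' => x <-; rewrite max_l.
have h0 x : 0 <= Num.max (f' x) 0 by rewrite le_max lexx orbT.
split => //; last exact: ge0_ae_eq_integral_fin.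
exact: measurable_maxr.
Qed.

Lemma ae_measurableP f : measurable_fun setT f -> ae_measurable f.
Proof. by move=> mf; exists f => //; apply: aeW. Qed.

Lemma ae_measurable_comp f (h : R -> R) :
  measurable_fun setT h -> ae_measurable f -> ae_measurable (fun x => h (f x)).
Proof.
move=> mh [f' mf' e]; exists (h \o f'); first exact: measurableT_comp.
by apply: filterS e => x /= ->.
Qed.

Lemma ae_measurableD f g :
  ae_measurable f -> ae_measurable g -> ae_measurable (fun x => f x + g x).
Proof.
move=> [f' mf' ef] [g' mg' eg]; exists (f' \+ g'); first exact: measurable_funD.
by apply: filterS2 ef eg => x /= -> ->.
Qed.

Lemma ae_measurable_lim (f_ : nat -> T -> R) f : (forall n, ae_measurable (f_ n)) ->
  {ae mu, forall x, f_ n x @[n --> \oo] --> f x} -> ae_measurable f.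
Proof.
move=> mf_ cf.
have [f' hf'] := choice (fun n => let: ex_intro2 f' m e := mf_ n in
  ex_intro (fun f' => measurable_fun setT f' /\
    {ae mu, forall x, f_ n x = f' x}) f' (conj m e)).
have ef : {ae mu, forall x n, f_ n x = f' n x}.
  have : mu.-negligible (\bigcup_n ~` [set x | f_ n x = f' n x]).
    by apply: negligible_bigcup => n; have [_] := hf' n.
  by apply: negligibleS => x /= /existsNP[n hn]; exists n.
have [N [mN N0 hN]] : {ae mu, forall x, f' n x @[n --> \oo] --> f x}.
  by apply: filterS2 ef cf => x e; under eq_fun do rewrite e.
have mNC : measurable (~` N) by exact: measurableC.
(* Cut off on one common null set, the limit holds everywhere and measurability passes to it. *)
exists (fun x => f x * \1_(~` N) x); last first.
  exists N; split => // x /=; apply: contra_notP => Nx.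
  by rewrite /indic mem_set// mulr1.
apply: (@measurable_fun_cvg _ _ _ _ (fun n x => f' n x * \1_(~` N) x)).
  move=> n; apply: measurable_funM; first by have [] := hf' n.
  exact: measurable_indic.
move=> x _; rewrite /indic; have [Nx|Nx] := pselect (N x).
  rewrite memNset ?mulr0; last by move=> /(_ Nx).
  by under eq_fun do rewrite mulr0; exact: cvg_cst.
rewrite mem_set// mulr1; under eq_fun do rewrite mulr1.
by apply: contrapT => h; exact/Nx/hN.
Qed.

Lemma ge0_ae_integralD f g : ae_measurable f -> ae_measurable g ->
  (forall x, 0 <= f x) -> (forall x, 0 <= g x) ->
  (\int[mu]_x (f x + g x)%:E = \int[mu]_x (f x)%:E + \int[mu]_x (g x)%:E)%E.
Proof.
move=> mf mg f0 g0.
have [f' [mf' f'0 ef ->]] := ae_measurable_ge0 mf f0.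
have [g' [mg' g'0 eg ->]] := ae_measurable_ge0 mg g0.
rewrite (@ge0_ae_eq_integral_fin (fun x => f x + g x) (fun x => f' x + g' x)).
- rewrite -ge0_integralD//.
  + by move=> x _; rewrite lee_fin.
  + exact/measurable_EFinP.
  + by move=> x _; rewrite lee_fin.
  + exact/measurable_EFinP.
- by move=> x; rewrite addr_ge0.
- by move=> x; rewrite addr_ge0.
- by apply: filterS2 ef eg => x -> ->.
Qed.

Lemma ge0_ae_integralZl f (k : R) : ae_measurable f -> (forall x, 0 <= f x) ->
  0 <= k -> (\int[mu]_x (k * f x)%:E = k%:E * \int[mu]_x (f x)%:E)%E.
Proof.
move=> mf f0 k0; have [f' [mf' f'0 ef ->]] := ae_measurable_ge0 mf f0.
rewrite (@ge0_ae_eq_integral_fin (fun x => k * f x) (fun x => k * f' x)).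
- rewrite -ge0_integralZl//.
  + exact/measurable_EFinP.
  by move=> x _; rewrite lee_fin.
- by move=> x; rewrite mulr_ge0.
- by move=> x; rewrite mulr_ge0.
- by apply: filterS ef => x ->.
Qed.

(** By monotone convergence the sum of the series has integral at most 2c, so it is finite almost
    everywhere. *)
Lemma ae_summable (f_ : nat -> T -> R) (c : R) :
  (forall n, ae_measurable (f_ n)) -> (forall n x, 0 <= f_ n x) ->
  (forall n, (\int[mu]_x (f_ n x)%:E <= (c * 2^-1 ^+ n)%:E)%E) ->
  {ae mu, forall x, cvgn (series (f_ ^~ x))}.
Proof.
move=> mf_ f0 hc.
have [f' hf'] := choice (fun n => ae_measurable_ge0 (mf_ n) (f0 n)).
have ef : {ae mu, forall x n, f_ n x = f' n x}.
  have : mu.-negligible (\bigcup_n ~` [set x | f_ n x = f' n x]).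
    by apply: negligible_bigcup => n; have [_ _] := hf' n.
  by apply: negligibleS => x /= /existsNP[n hn]; exists n.
pose g x := (\sum_(0 <= n <oo) (f' n x)%:E)%E.
have mf' n : measurable_fun setT (fun x => (f' n x)%:E).
  by apply/measurable_EFinP; have [] := hf' n.
have f'0 n x : (0 <= (f' n x)%:E)%E by rewrite lee_fin; have [_ ->] := hf' n.
have mg : measurable_fun setT g by apply: ge0_emeasurable_sum => // *.
have g0 x : (0 <= g x)%E by apply: nneseries_ge0.
have gfin : (\int[mu]_x g x < +oo)%E.
  have c0 : 0 <= c.
    have /le_trans/(_ (hc 0%N)) : (0 <= \int[mu]_x (f_ 0%N x)%:E)%E.
      by apply: integral_ge0 => x _; rewrite lee_fin.
    by rewrite lee_fin expr0 mulr1.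
  rewrite integral_nneseries//.
  apply: (@le_lt_trans _ _ (2 * c)%:E); last exact: ltry.
  apply: lime_le; first by apply: is_cvg_nneseries => n _ _; exact: integral_ge0.
  apply: nearW => m; apply: (@le_trans _ _ (2 * c * (1 - 2^-1 ^+ m))%:E); last first.
    rewrite lee_fin; apply: ler_piMr; first by rewrite mulr_ge0.
    by rewrite lerBlDr lerDl exprn_ge0// invr_ge0.
  elim: m => [|m IH]; first by rewrite big_geq// expr0 subrr mulr0.
  rewrite big_nat_recr//=; have [_ _ _ <-] := hf' m.
  apply: le_trans (leeD IH (hc m)) _; rewrite -EFinD lee_fin exprS; lra.
have : {ae mu, forall x, setT x -> g x \is a fin_num}.
  apply: integrable_ae => //; apply/integrableP; split => //.
  by under eq_integral do rewrite gee0_abs//.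
apply: filterS2 ef => x ef /(_ I) gx; under eq_fun do rewrite ef.
apply: nondecreasing_is_cvgn.
  apply/nondecreasing_seqP => n; rewrite seriesSr lerDl.
  by have [_ ->] := hf' n.
exists (fine (g x)) => _ [n _ <-]; rewrite -lee_fin fineK// /g.
rewrite /series/= -sumEFin.
exact: (nneseries_lim_ge (P := xpredT)).
Qed.

End LowerIntegral.

(** * Translation invariance of Lebesgue measure *)

Section Translation.
Context {R : realType}.
Local Notation leb := (@lebesgue_measure R).

#[global] Instance ae_lebesgue_filter : Filter (nbhs (almost_everywhere leb)).
Proof. exact: ae_filter_ringOfSetsType. Qed.

Lemma measurable_preimage_shift (a : R) (A : set R) : measurable A ->
  measurable ((fun s => s + a) @^-1` A).
Proof.
have ms : measurable_fun setT (fun s : R => s + a) by exact: measurable_funD.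
by move=> mA; rewrite -[X in measurable X]setTI; exact: ms.
Qed.

(** The image of Lebesgue measure under the translation has the right values on half-open intervals,
    and these determine the measure. *)
Lemma lebesgue_measure_shift (a : R) (A : set R) : measurable A ->
  leb ((fun s => s + a) @^-1` A) = leb A.
Proof.
move=> mA; rewrite -/(pushforward leb ((fun s => s + a) : _ -> measurableTypeR R) A).
apply/esym/lebesgue_measure_unique => //=; first exact: measurable_funD.
move=> ms _ [[b c]] _ <-.
rewrite /pushforward/= (_ : _ @^-1` _ = `](b - a), (c - a)]%classic).
  rewrite !lebesgue_measure_itv/= !lte_fin ltrD2r.
  by case: ifP => // _; rewrite -!EFinD; congr EFin; lra.
by apply/seteqP; split => s; rewrite /= !in_itv/= ltrBlDr lerBrDr.
Qed.

Lemma ae_shift (a : R) (P : R -> Prop) :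
  {ae leb, forall s, P s} -> {ae leb, forall s, P (s + a)}.
Proof.
move=> [N [mN N0 PN]]; exists ((fun s => s + a) @^-1` N).
split; [exact: measurable_preimage_shift| |by move=> s /PN].
by rewrite lebesgue_measure_shift.
Qed.

Lemma ge0_integral_shift (a : R) (f : R -> R) :
  ae_measurable leb f -> (forall s, 0 <= f s) ->
  (\int[leb]_s (f (s + a))%:E = \int[leb]_s (f s)%:E)%E.
Proof.
move=> mf f0; have [f' [mf' f'0 e ->]] := ae_measurable_ge0 mf f0.
rewrite (@ge0_ae_eq_integral_fin _ _ _ leb (fun s => f (s + a))
  (fun s => f' (s + a)))//; last exact: ae_shift e.
pose h : measurableTypeR R -> measurableTypeR R := fun s => s + a.
have mh : measurable_fun setT h by exact: measurable_funD.
have <- : (\int[pushforward leb h]_s (f' s)%:E = \int[leb]_s (f' (s + a))%:E)%E.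
  rewrite (ge0_integral_pushforward mh)//; first exact/measurable_EFinP.
  by move=> s _; rewrite lee_fin.
apply: eq_measure_integral => A mA _.
exact: lebesgue_measure_shift.
Qed.

End Translation.

(** * Bochner integrals over the real line *)

Section StepFunctions.
Context {R : realType} {K : numFieldType} (S : scalars R K).
Local Notation leb := (@lebesgue_measure R).
Implicit Types E F : normedModType K.

(** Turns a function on an interval into one on the line, so that concatenation of inputs becomes
    addition and a time shift leaves the domain of integration alone. *)
Definition zero_ext {E} (D : set R) (f : R -> E) (s : R) : E :=
  if s \in D then f s else 0.

(* [step_function g W]: g is a linear combination of indicator functions of
   sets of finite measure, and W D is its integral over D. *)
Inductive step_function {E} : (R -> E) -> (set R -> E) -> Prop :=
| step_function0 : step_function (fun=> 0) (fun=> 0)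
| step_functionS A e g W : measurable A -> (leb A < +oo)%E -> step_function g W ->
    step_function (fun s => zero_ext A (fun=> e) s + g s)
      (fun D => ofR S (fine (leb (A `&` D))) *: e + W D).

Lemma step_function_ext E (g g' : R -> E) W W' : step_function g W ->
  g =1 g' -> W =1 W' -> step_function g' W'.
Proof. by move=> gW /funext <- /funext <-. Qed.

Lemma step_functionD E (g g' : R -> E) W W' :
  step_function g W -> step_function g' W' ->
  step_function (fun s => g s + g' s) (fun D => W D + W' D).
Proof.
move=> gW gW'; elim: gW => [|A e h V mA Afin _ IH].
  by apply: step_function_ext gW' _ _ => ?; rewrite add0r.
by apply: step_function_ext (step_functionS e mA Afin IH) _ _ => ?; rewrite addrA.
Qed.

Lemma step_function_map E F (L : {linear E -> F}) (g : R -> E) W :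
  step_function g W -> step_function (fun s => L (g s)) (fun D => L (W D)).
Proof.
elim=> [|A e h V mA Afin _ IH].
  by apply: step_function_ext step_function0 _ _ => ?; rewrite linear0.
apply: step_function_ext (step_functionS (L e) mA Afin IH) _ _ => s.
  by rewrite linearD /zero_ext; case: ifP; rewrite ?linear0.
by rewrite linearD linearZ.
Qed.

Lemma step_functionZ E (a : R) (g : R -> E) W : step_function g W ->
  step_function (fun s => ofR S a *: g s) (fun D => ofR S a *: W D).
Proof.
elim=> [|A e h V mA Afin _ IH].
  by apply: step_function_ext step_function0 _ _ => ?; rewrite scaler0.
apply: step_function_ext (step_functionS (ofR S a *: e) mA Afin IH) _ _ => s.
  by rewrite scalerDr /zero_ext; case: ifP; rewrite ?scaler0.
by rewrite scalerDr !scalerA mulrC.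
Qed.

Lemma step_function_shift E (a : R) (g : R -> E) W : step_function g W ->
  exists2 W', step_function (fun s => g (s + a)) W' & W' setT = W setT.
Proof.
elim=> [|A e h V mA Afin _ [V' hV' VE]]; first by eexists; first exact: step_function0.
have mA' := measurable_preimage_shift a mA.
have Afin' : (leb ((fun s => s + a)%R @^-1` A) < +oo)%E.
  by rewrite lebesgue_measure_shift.
have := step_functionS e mA' Afin' hV' => st; eexists.
  apply: step_function_ext st _ (fun=> erefl) => s.
  by congr (_ + _); rewrite /zero_ext; congr (if _ then _ else _);
    apply/idP/idP => /set_mem/mem_set.
by rewrite /= VE !setIT lebesgue_measure_shift.
Qed.

(** The norm of a sum is not a function of the two norms, so the induction carries a constant c that
    absorbs the value e on A. *)
Lemma step_function_norm_measurable E (g : R -> E) W (c : E) :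
  step_function g W -> measurable_fun setT (fun s => rnorm S (c + g s)).
Proof.
move=> gW; elim: gW c => [|A e h V mA Afin _ IH] c; first exact: measurable_cst.
rewrite -(setUv A); apply/measurable_funU => //; first exact: measurableC.
split.
  apply: (eq_measurable_fun (fun s => rnorm S ((c + e) + h s))).
    by move=> s /set_mem As; rewrite /zero_ext mem_set// addrA.
  exact: measurable_funTS.
apply: (eq_measurable_fun (fun s => rnorm S (c + h s))).
  by move=> s /set_mem As; rewrite /zero_ext memNset// add0r.
exact: measurable_funTS.
Qed.

Lemma fine_lebD (A B D : set R) : measurable A -> measurable B ->
  A `&` B = set0 -> A `|` B = D -> (leb D < +oo)%E ->
  fine (leb D) = fine (leb A) + fine (leb B).
Proof.
move=> mA mB AB0 ABD; rewrite -ABD measureU// => Dfin.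
rewrite fineD//; apply/fin_numPlt/andP; split.
- by rewrite (lt_le_trans _ (measure_ge0 _ _))// ltNye.
- by rewrite (le_lt_trans _ Dfin)// leeDl.
- by rewrite (lt_le_trans _ (measure_ge0 _ _))// ltNye.
- by rewrite (le_lt_trans _ Dfin)// leeDr.
Qed.

Lemma step_function_additive E (g : R -> E) W (A B D : set R) :
  step_function g W -> measurable A -> measurable B ->
  A `&` B = set0 -> A `|` B = D -> W D = W A + W B.
Proof.
move=> gW mA mB AB0 ABD; elim: gW => [|C e h V mC Cfin _ ->].
  by rewrite addr0.
have -> : fine (leb (C `&` D)) = fine (leb (C `&` A)) + fine (leb (C `&` B)).
  apply: fine_lebD.
  - exact: measurableI.
  - exact: measurableI.
  - by rewrite setIACA setIid AB0 setI0.
  - by rewrite -setIUr ABD.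
  - apply: le_lt_trans Cfin; apply: le_measure; rewrite ?inE//.
    by apply: measurableI => //; rewrite -ABD; exact: measurableU.
by rewrite rmorphD scalerDl addrACA.
Qed.

(** Induction on the representation, with c and D general: on the part of D inside A the constant
    becomes c + e, on the rest it stays c. No passage to disjoint sets is required. The side
    condition keeps the term leb(D) c meaningful when D is the whole line. This estimate is what
    makes the integral independent of the representation. *)
Lemma step_function_le_norm E (g : R -> E) W (D : set R) (c : E) :
  step_function g W -> measurable D -> c = 0 \/ (leb D < +oo)%E ->
  ((rnorm S (ofR S (fine (leb D)) *: c + W D))%:E <=
   \int[leb]_(s in D) (rnorm S (c + g s))%:E)%E.
Proof.
move=> gW; elim: gW D c => [|A e h V mA Afin hV IH] D c mD hD.
  rewrite addr0; under eq_integral do rewrite addr0.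
  rewrite integral_cst//; case: hD => [->|Dfin].
    by rewrite scaler0 rnorm0 mul0e.
  have Dfin' : leb D \is a fin_num by rewrite ge0_fin_numE.
  rewrite rnormZ ger0_norm ?fine_ge0// -[leRHS]muleC.
  by rewrite -[X in (_ <= X * _)%E](fineK Dfin').
pose D1 := A `&` D; pose D2 := D `\` A.
have mD1 : measurable D1 by exact: measurableI.
have mD2 : measurable D2 by exact: measurableD.
have D120 : D1 `&` D2 = set0.
  by rewrite /D1 /D2 setDE setIACA [D `&` _]setIC -setIACA setICr set0I.
have D12 : D1 `|` D2 = D by rewrite /D1 /D2 [A `&` D]setIC setUIDK.
have D1fin : (leb D1 < +oo)%E.
  apply: le_lt_trans Afin; apply: le_measure; rewrite ?inE//; exact: subIsetl.
rewrite (step_function_additive hV mD1 mD2 D120 D12).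
have -> : ofR S (fine (leb D)) *: c =
    ofR S (fine (leb D1)) *: c + ofR S (fine (leb D2)) *: c.
  case: hD => [->|Dfin]; first by rewrite !scaler0 addr0.
  by rewrite (fine_lebD mD1 mD2)// rmorphD scalerDl.
rewrite -D12 ge0_integral_setU//; last 3 first.
- apply/measurable_EFinP/measurable_funTS.
  exact: (step_function_norm_measurable _ (step_functionS e mA Afin hV)).
- by move=> s _; rewrite lee_fin rnorm_ge0.
- by apply/disj_setPS; rewrite D120.
have -> : (\int[leb]_(s in D1) (rnorm S (c + (zero_ext A (fun=> e) s + h s))%R)%:E =
    \int[leb]_(s in D1) (rnorm S (c + e + h s)%R)%:E)%E.
  by apply: eq_integral => s /set_mem[As _]; rewrite /zero_ext mem_set// addrA.
have -> : (\int[leb]_(s in D2) (rnorm S (c + (zero_ext A (fun=> e) s + h s))%R)%:E =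
    \int[leb]_(s in D2) (rnorm S (c + h s)%R)%:E)%E.
  by apply: eq_integral => s /set_mem[_ As]; rewrite /zero_ext memNset// add0r.
apply: le_trans (leeD (IH D1 (c + e) mD1 (or_intror D1fin)) (IH D2 c mD2 _)); last first.
  case: hD => [->|Dfin]; [by left|right].
  apply: le_lt_trans Dfin; apply: le_measure; rewrite ?inE//; exact: subDsetl.
rewrite -EFinD lee_fin; apply: le_trans (rnormD _ _ _).
have aux (x x' y v v' : E) : x + x' + (y + (v + v')) = x + y + v + (x' + v').
  by rewrite addrACA [x' + (v + v')]addrCA addrA.
by rewrite aux scalerDr D12.
Qed.
End StepFunctions.

(** * Strong measurability and the Bochner integral on the line *)

Section LineIntegral.
Context {R : realType} {K : numFieldType} (S : scalars R K).
Local Notation leb := (@lebesgue_measure R).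
Implicit Types E F : normedModType K.

Lemma zero_extT E (D : set R) (f : R -> E) s : D s -> zero_ext D f s = f s.
Proof. by move=> Ds; rewrite /zero_ext mem_set. Qed.

Lemma zero_extN E (D : set R) (f : R -> E) s : ~ D s -> zero_ext D f s = 0.
Proof. by move=> Ds; rewrite /zero_ext memNset. Qed.

Lemma step_function_simple E (g : R -> E) W (D : set R) :
  step_function S g W -> measurable D -> simple_on D g.
Proof.
move=> gW mD; suff [fg mg] : finite_set (range g) /\
    forall v, measurable (g @^-1` [set v]).
  split=> [|v]; last exact: measurableI.
  by apply: sub_finite_set fg => _ [s _ <-]; exists s.
elim: gW => [|A e h V mA Afin _ [fh mh]]; split.
- by apply: (@sub_finite_set _ _ [set 0]) => // _ [s _ <-].
- move=> v; have [->|v0] := eqVneq v 0.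
    by rewrite (_ : _ @^-1` _ = setT)//; apply/seteqP; split.
  rewrite (_ : _ @^-1` _ = set0)//; apply/seteqP; split => // s /= v0'.
  by move: v0; rewrite -v0' eqxx.
- apply: (@sub_finite_set _ _ (range h `|` (fun x => e + x) @` range h)).
    move=> _ [s _ <-]; have [As|As] := pselect (A s).
      by rewrite zero_extT//; right; exists (h s) => //; exists s.
    by rewrite zero_extN// add0r; left; exists s.
  by rewrite finite_setU; split => //; exact: finite_image.
- move=> v; rewrite (_ : _ @^-1` _ = (A `&` h @^-1` [set v - e]) `|`
      (~` A `&` h @^-1` [set v])).
    by apply: measurableU; apply: measurableI => //; exact: measurableC.
  apply/seteqP; split => s /=; have [As|As] := pselect (A s).
  + by rewrite zero_extT// => <-; left; split => //; rewrite addrAC subrr add0r.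
  + by rewrite zero_extN// add0r => <-; right.
  + by rewrite zero_extT// => -[[_ ->]|[/(_ As)]//]; rewrite addrC subrK.
  + by rewrite zero_extN// add0r => -[[/As]//|[_ ->]].
Qed.

(** The level sets within D have finite measure, and at each point of D exactly one of them
    contributes. *)
Lemma simple_on_step E (g : R -> E) (D : set R) : measurable D ->
  (leb D < +oo)%E -> simple_on D g ->
  exists2 W, step_function S (zero_ext D g) W & W setT = simple_integral S D g.
Proof.
move=> mD Dfin [fg mg].
have st (l : seq E) : step_function S
    (fun s => \sum_(v <- l) zero_ext (D `&` g @^-1` [set v]) (fun=> v) s)
    (fun D' => \sum_(v <- l) ofR S (fine (leb (D `&` g @^-1` [set v] `&` D'))) *: v).
  elim: l => [|v l IH].
    by apply: step_function_ext (step_function0 _) _ _ => ?; rewrite big_nil.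
  have vfin : (leb (D `&` g @^-1` [set v]) < +oo)%E.
    apply: le_lt_trans Dfin; apply: le_measure; rewrite ?inE//; exact: mg.
  by apply: step_function_ext (step_functionS v (mg v) vfin IH) _ _ => ?;
    rewrite big_cons.
have := st (finmap.enum_fset (fset_set (g @` D))); set W := (X in step_function _ _ X) => hW.
exists W; last first.
  rewrite /W /simple_integral fsbig_finite//; apply: eq_bigr => v _.
  by rewrite setIT.
apply: step_function_ext hW _ (fun=> erefl) => s.
have [Ds|Ds] := pselect (D s); last first.
  by rewrite zero_extN// big1// => v _; rewrite zero_extN// => -[/Ds].
rewrite zero_extT// (bigD1_seq (g s)) ?finmap.fset_uniq//=; last first.
  by rewrite in_fset_set// inE; exists s.
rewrite zero_extT// big1 ?addr0// => v /eqP vg.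
by rewrite zero_extN// => -[_ gv]; apply: vg; rewrite -gv.
Qed.

Definition line_measurable E (f : R -> E) : Prop :=
  exists g W, (forall n, step_function S (g n) (W n)) /\
    {ae leb, forall s, g n s @[n --> \oo] --> f s}.

Definition line_integral E (f : R -> E) (v : E) : Prop :=
  line_measurable f /\ exists g W, [/\ forall n, step_function S (g n) (W n),
    (\int[leb]_s (rnorm S (f s - g n s))%:E)%E @[n --> \oo] --> 0%E &
    W n setT @[n --> \oo] --> v].

Lemma step_line_measurable E (g : R -> E) W :
  step_function S g W -> line_measurable g.
Proof.
move=> gW; exists (fun=> g), (fun=> W); split => //.
by apply: aeW => s; exact: cvg_cst.
Qed.

Lemma line_measurableD E (f f' : R -> E) : line_measurable f ->
  line_measurable f' -> line_measurable (fun s => f s + f' s).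
Proof.
move=> [g [W [gW gf]]] [g' [W' [gW' gf']]].
exists (fun n s => g n s + g' n s), (fun n D => W n D + W' n D); split.
  by move=> n; exact: step_functionD.
by apply: filterS2 gf gf' => s; exact: cvgD.
Qed.

Lemma line_measurable_map E F (L : {linear E -> F}) (f : R -> E) :
  bounded_op S L -> line_measurable f -> line_measurable (fun s => L (f s)).
Proof.
move=> Lb [g [W [gW gf]]].
exists (fun n s => L (g n s)), (fun n D => L (W n D)); split.
  by move=> n; exact: step_function_map.
by apply: filterS gf => s; exact: (bounded_op_cvg Lb).
Qed.

Lemma line_measurableZ E (a : R) (f : R -> E) :
  line_measurable f -> line_measurable (fun s => ofR S a *: f s).
Proof.
move=> [g [W [gW gf]]].
exists (fun n s => ofR S a *: g n s), (fun n D => ofR S a *: W n D); split.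
  by move=> n; exact: step_functionZ.
by apply: filterS gf => s; exact: cvgZr.
Qed.

Lemma line_measurableB E (f f' : R -> E) : line_measurable f ->
  line_measurable f' -> line_measurable (fun s => f s - f' s).
Proof.
move=> mf /(line_measurableZ (-1)); rewrite rmorphN1.
by under [X in line_measurable X]eq_fun do rewrite scaleN1r; exact: line_measurableD.
Qed.

Lemma line_measurable_sum E (f : nat -> R -> E) n :
  (forall k, line_measurable (f k)) ->
  line_measurable (fun s => \sum_(0 <= k < n) f k s).
Proof.
move=> mf; elim: n => [|n IH].
  by under eq_fun do rewrite big_geq//; exact: step_line_measurable (step_function0 _).
under eq_fun do rewrite big_nat_recr//=.
exact: line_measurableD.
Qed.

Lemma line_measurable_shift E (a : R) (f : R -> E) :
  line_measurable f -> line_measurable (fun s => f (s + a)).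
Proof.
move=> [g [W [gW gf]]].
have [W' hW'] := choice (fun n => let: ex_intro2 W' h e := step_function_shift a (gW n) in
  ex_intro (fun W' => step_function S (fun s => g n (s + a)) W') W' h).
exists (fun n s => g n (s + a)), W'; split => //.
exact: (ae_shift a gf).
Qed.

Lemma step_function_restrict E (g : R -> E) W (D : set R) :
  step_function S g W -> measurable D ->
  step_function S (zero_ext D g) (fun D' => W (D `&` D')).
Proof.
move=> gW mD; elim: gW => [|A e h V mA Afin _ IH].
  by apply: step_function_ext (step_function0 _) _ _ => // s; rewrite /zero_ext; case: ifP.
have mAD : measurable (A `&` D) by exact: measurableI.
have ADfin : (leb (A `&` D) < +oo)%E.
  apply: le_lt_trans Afin; apply: le_measure; rewrite ?inE//; exact: subIsetl.
apply: step_function_ext (step_functionS e mAD ADfin IH) _ _ => [s|D'].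
  by rewrite /zero_ext in_setI; case: (s \in A); case: (s \in D); rewrite /= ?addr0.
by rewrite setIA.
Qed.

Lemma line_measurable_restrict E (f : R -> E) (D : set R) :
  line_measurable f -> measurable D -> line_measurable (zero_ext D f).
Proof.
move=> [g [W [gW gf]]] mD.
exists (fun n => zero_ext D (g n)), (fun n D' => W n (D `&` D')); split.
  by move=> n; exact: step_function_restrict.
apply: filterS gf => s gf; rewrite /zero_ext; case: ifP => // _; exact: cvg_cst.
Qed.

Lemma line_measurable_norm E (f : R -> E) :
  line_measurable f -> ae_measurable leb (fun s => rnorm S (f s)).
Proof.
move=> [g [W [gW gf]]].
apply: (@ae_measurable_lim _ _ _ leb (fun n s => rnorm S (g n s))).
  move=> n; apply: ae_measurableP.
  have := step_function_norm_measurable 0 (gW n).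
  by under eq_fun do rewrite add0r.
by apply: filterS gf => s; exact: cvg_rnorm.
Qed.

Lemma step_function_le_integral E (g : R -> E) W : step_function S g W ->
  ((rnorm S (W setT))%:E <= \int[leb]_s (rnorm S (g s))%:E)%E.
Proof.
move=> gW; have := step_function_le_norm gW measurableT (or_introl erefl).
rewrite scaler0 add0r; congr (_ <= _)%E.
by apply: eq_integral => s _; rewrite add0r.
Qed.

(** |W_n| is at most the integral of |g_n|, hence at most that of |f| plus that of |f - g_n|, and
    the last one tends to 0. *)
Lemma line_integral_le E (f : R -> E) v : line_integral f v ->
  ((rnorm S v)%:E <= \int[leb]_s (rnorm S (f s))%:E)%E.
Proof.
move=> [mf [g [W [gW gf Wv]]]].
apply: (@lee_cvg_to nat \oo _ _ (fun n => (rnorm S (W n setT))%:E)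
  (fun n => \int[leb]_s (rnorm S (f s))%:E +
            \int[leb]_s (rnorm S (f s - g n s)%R)%:E)%E).
- apply: cvg_EFin; last exact: cvg_rnorm Wv.
  by apply: nearW => n.
- rewrite -[X in _ --> X]adde0; apply: cvgeD => //; last exact: cvg_cst.
  by rewrite fin_num_adde_defl.
apply: nearW => n; apply: le_trans (step_function_le_integral (gW n)) _.
rewrite -ge0_ae_integralD//; last 4 first.
- exact: line_measurable_norm.
- by apply/line_measurable_norm/line_measurableB => //; exact: step_line_measurable (gW n).
- by move=> s; exact: rnorm_ge0.
- by move=> s; exact: rnorm_ge0.
apply: ge0_ae_le_integral => [s|s|]; rewrite ?addr_ge0 ?rnorm_ge0//.
by apply: aeW => s; rewrite -{1}(subKr (f s) (g n s)) rnormB.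
Qed.

Lemma line_integralD E (f f' : R -> E) v v' : line_integral f v ->
  line_integral f' v' -> line_integral (fun s => f s + f' s) (v + v').
Proof.
move=> [mf [g [W [gW gf Wv]]]] [mf' [g' [W' [gW' gf' Wv']]]].
split; first exact: line_measurableD.
exists (fun n s => g n s + g' n s), (fun n D => W n D + W' n D); split.
- by move=> n; exact: step_functionD.
- apply: (squeeze_cvge (f := cst 0%E) (h := fun n =>
    (\int[leb]_s (rnorm S (f s - g n s))%:E +
     \int[leb]_s (rnorm S (f' s - g' n s))%:E)%E)).
  + apply: nearW => n; rewrite integral_ge0 => [|s _]; last by rewrite lee_fin rnorm_ge0.
    rewrite -ge0_ae_integralD => //; last 4 first.
    * by apply/line_measurable_norm/line_measurableB => //; exact: step_line_measurable (gW n).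
    * by apply/line_measurable_norm/line_measurableB => //; exact: step_line_measurable (gW' n).
    * by move=> s; exact: rnorm_ge0.
    * by move=> s; exact: rnorm_ge0.
    apply: ge0_ae_le_integral => [s|s|]; rewrite ?addr_ge0 ?rnorm_ge0//.
    by apply: aeW => s; rewrite opprD addrACA rnormD.
  + exact: cvg_cst.
  + by rewrite -[X in _ --> X](adde0 0%E); exact: cvgeD.
- exact: cvgD.
Qed.

Lemma line_integral_map E F (L : {linear E -> F}) (f : R -> E) v :
  bounded_op S L -> line_integral f v -> line_integral (fun s => L (f s)) (L v).
Proof.
move=> Lb [mf [g [W [gW gf Wv]]]]; split; first exact: line_measurable_map.
exists (fun n s => L (g n s)), (fun n D => L (W n D)); split.
- by move=> n; exact: step_function_map.
- have [M hM] := Lb.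
  apply: (squeeze_cvge (f := cst 0%E) (h := fun n =>
    (`|M|%:E * \int[leb]_s (rnorm S (f s - g n s))%:E)%E)).
  + apply: nearW => n; rewrite integral_ge0 => [|s _]; last by rewrite lee_fin rnorm_ge0.
    rewrite -ge0_ae_integralZl//; last 2 first.
    * by apply/line_measurable_norm/line_measurableB => //; exact: step_line_measurable (gW n).
    * by move=> s; exact: rnorm_ge0.
    apply: ge0_ae_le_integral => [s|s|]; rewrite ?mulr_ge0 ?rnorm_ge0//.
    apply: aeW => s; rewrite -linearB (le_trans (hM _))//.
    by rewrite ler_wpM2r ?rnorm_ge0// ler_norm.
  + exact: cvg_cst.
  + by rewrite -[X in _ --> X](mule0 `|M|%:E); exact: cvgeZl.
- exact: (bounded_op_cvg Lb).
Qed.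

Lemma bounded_op_scale E (a : R) : bounded_op S ( *:%R (ofR S a) : E -> E).
Proof. by exists `|a| => x; rewrite rnormZ. Qed.

Lemma line_integralZ E (a : R) (f : R -> E) v : line_integral f v ->
  line_integral (fun s => ofR S a *: f s) (ofR S a *: v).
Proof. exact: (@line_integral_map _ _ ( *:%R (ofR S a)) f v (@bounded_op_scale E a)). Qed.

Lemma line_integralB E (f f' : R -> E) v v' : line_integral f v ->
  line_integral f' v' -> line_integral (fun s => f s - f' s) (v - v').
Proof.
move=> hf /(line_integralZ (-1)); rewrite rmorphN1 scaleN1r.
by under [X in line_integral X]eq_fun do rewrite scaleN1r; exact: line_integralD.
Qed.

(** The norm estimate is applied to the difference, whose integrand vanishes a.e. This is how states
    are compared later: by comparing integrands. *)
Lemma line_integral_unique E (f f' : R -> E) v v' : line_integral f v ->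
  line_integral f' v' -> {ae leb, forall s, f s = f' s} -> v = v'.
Proof.
move=> hf hf' ff'; have := line_integral_le (line_integralB hf hf').
rewrite (@ge0_ae_eq_integral_fin _ _ _ leb _ (fun=> 0)) => [|s|s|]; last 3 first.
- exact: rnorm_ge0.
- by [].
- by apply: filterS ff' => s ->; rewrite subrr rnorm0.
rewrite integral0 lee_fin => h; apply/subr0_eq/(@rnorm_eq0 _ _ S).
by apply/eqP; rewrite eq_le h rnorm_ge0.
Qed.

Lemma line_integral_shift E (a : R) (f : R -> E) v : line_integral f v ->
  line_integral (fun s => f (s + a)) v.
Proof.
move=> [mf [g [W [gW gf Wv]]]]; split; first exact: line_measurable_shift.
have [W' hW'] := choice (fun n => let: ex_intro2 W' h e := step_function_shift a (gW n) in
  ex_intro (fun W' => step_function S (fun s => g n (s + a)) W' /\ W' setT = W n setT)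
    W' (conj h e)).
exists (fun n s => g n (s + a)), W'; split.
- by move=> n; have [] := hW' n.
- under eq_fun => n.
    rewrite (@ge0_integral_shift _ a (fun s => rnorm S (f s - g n s))); last 2 first.
    + by apply/line_measurable_norm/line_measurableB => //; exact: step_line_measurable (gW n).
    + by move=> s; exact: rnorm_ge0.
  over.
  exact: gf.
- by under eq_fun => n do have [_ ->] := hW' n.
Qed.

(** Step functions are built on sets of finite measure while [simple_on] allows any level sets;
    finite measure of D reconciles the two. *)
Lemma strongly_measurable_line E (D : set R) (f : R -> E) : measurable D ->
  (leb D < +oo)%E -> strongly_measurable D f <-> line_measurable (zero_ext D f).
Proof.
move=> mD Dfin; split=> [[g [gs gf]]|[g [W [gW gf]]]].
  have [W hW] := choice (fun n => let: ex_intro2 W h _ := simple_on_step mD Dfin (gs n) in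
    ex_intro (fun W => step_function S (zero_ext D (g n)) W) W h).
  exists (fun n => zero_ext D (g n)), W; split => //.
  apply: filterS gf => s gf; have [Ds|Ds] := pselect (D s).
    by rewrite zero_extT//; under eq_fun do rewrite zero_extT//; exact: gf.
  by rewrite zero_extN//; under eq_fun do rewrite zero_extN//; exact: cvg_cst.
exists g; split=> [n|]; first exact: step_function_simple (gW n) mD.
by apply: filterS gf => s gf Ds; rewrite zero_extT in gf.
Qed.

(** Used with h the identity for Bochner integrals and with h the p-th power for L^p. *)
Lemma integral_zero_ext E (D : set R) (f : R -> E) (h : R -> R) : h 0 = 0 ->
  (\int[leb]_(s in D) (h (rnorm S (f s)))%:E =
   \int[leb]_s (h (rnorm S (zero_ext D f s)))%:E)%E.
Proof.
move=> h0; rewrite integral_mkcond; apply: eq_integral => s _.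
by rewrite /patch /zero_ext; case: ifP => // _; rewrite rnorm0 h0.
Qed.

Lemma bochner_line_integral E (D : set R) (f : R -> E) v : measurable D ->
  (leb D < +oo)%E -> is_bochner_integral S D f v -> line_integral (zero_ext D f) v.
Proof.
move=> mD Dfin [mf [g [gs gf Wv]]]; split; first exact/strongly_measurable_line.
have [W hW] := choice (fun n => let: ex_intro2 W h e := simple_on_step mD Dfin (gs n) in
    ex_intro (fun W => step_function S (zero_ext D (g n)) W /\
      W setT = simple_integral S D (g n)) W (conj h e)).
exists (fun n => zero_ext D (g n)), W; split.
- by move=> n; have [] := hW n.
- rewrite [X in X @ _](_ : _ = (fun n => \int[leb]_(s in D) (rnorm S (f s - g n s)%R)%:E)%E)//.
  apply/funext => n; rewrite (integral_zero_ext _ (fun s => f s - g n s) (h := id))//.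
  apply: eq_integral => s _; rewrite /zero_ext; case: ifP => // _.
  by rewrite subrr.
- by under eq_fun => n do have [_ ->] := hW n.
Qed.

End LineIntegral.

(** * Almost everywhere limits of strongly measurable functions *)

Section DominatedLimit.
Context {R : realType} {K : numFieldType} (S : scalars R K).
Local Notation leb := (@lebesgue_measure R).
Implicit Types E : normedModType K.

Lemma bounded_ae_cvg0 (D : set R) (h : nat -> R -> R) :
  measurable D -> (leb D < +oo)%E -> (forall n, ae_measurable leb (h n)) ->
  (forall n s, 0 <= h n s <= \1_D s) ->
  {ae leb, forall s, h n s @[n --> \oo] --> (0 : R)} ->
  (\int[leb]_s (h n s)%:E)%E @[n --> \oo] --> 0%E.
Proof.
move=> mD Dfin mh h01 h0.
have hge0 n s : 0 <= h n s by have /andP[] := h01 n s.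
have [h' hh'] := choice (fun n => ae_measurable_ge0 (mh n) (hge0 n)).
have ehh' : {ae leb, forall s n, h n s = h' n s}.
  have : leb.-negligible (\bigcup_n ~` [set x | h n x = h' n x]).
    by apply: negligible_bigcup => n; have [_ _] := hh' n.
  by apply: negligibleS => x /= /existsNP[n hn]; exists n.
under eq_fun => n do have [_ _ _ ->] := hh' n.
have mh' n : measurable_fun setT (fun s => (h' n s)%:E).
  by apply/measurable_EFinP; have [] := hh' n.
have [||||_ _ +] := @dominated_convergence _ _ R leb setT measurableT
  (fun n s => (h' n s)%:E) (cst 0%E) (EFin \o \1_D) mh'; last by rewrite integral0; apply.
- exact: measurable_cst.
- apply: filterS2 ehh' h0 => s e h0 _; apply: cvg_EFin; first exact: nearW.
  by apply: cvg_trans h0; apply: near_eq_cvg; apply: nearW => n /=.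
- apply/integrableP; split; first by apply/measurable_EFinP; exact: measurable_indic.
  under eq_integral => s _ do rewrite gee0_abs ?lee_fin//.
  by rewrite integral_indic// setIT.
- apply: filterS ehh' => s e n _ /=; rewrite -e ger0_norm ?lee_fin//.
  by have /andP[] := h01 n s.
Qed.

(** A diagonal argument: each f_n is replaced by a step function g_n so close that the truncated
    distances min(1, |f_n - g_n|) have summable integrals. Then they tend to 0 a.e., and g_n tends
    to f. The truncation, with the common support D of finite measure, supplies a majorant even when
    the f_n are not integrable. *)
Lemma line_measurable_lim E (D : set R) (f_ : nat -> R -> E) (f : R -> E) :
  measurable D -> (leb D < +oo)%E ->
  (forall n, line_measurable S (f_ n)) -> (forall n s, ~ D s -> f_ n s = 0) ->
  {ae leb, forall s, f_ n s @[n --> \oo] --> f s} -> line_measurable S f.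
Proof.
move=> mD Dfin mf_ f_0 f_f.
pose dist (g : R -> E) n s := Num.min 1 (rnorm S (f_ n s - g s)).
have mdist g W n : step_function S g W -> ae_measurable leb (dist g n).
  move=> gW; apply: (ae_measurable_comp (h := fun x => Num.min 1 x)).
    by apply: measurable_minr; [exact: measurable_cst|exact: measurable_id].
  exact/line_measurable_norm/line_measurableB/(step_line_measurable gW).
have near_step n : exists gW : (R -> E) * (set R -> E), step_function S gW.1 gW.2 /\
    (\int[leb]_s (dist gW.1 n s)%:E <= (1 * 2^-1 ^+ n)%:E)%E.
  have [g [W [gW gf]]] := mf_ n.
  have gW' m : step_function S (zero_ext D (g m)) (fun D' => W m (D `&` D')).
    exact: step_function_restrict.
  have : (\int[leb]_s (dist (zero_ext D (g m)) n s)%:E)%E @[m --> \oo] --> 0%E.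
    apply: (@bounded_ae_cvg0 D (fun m => dist (zero_ext D (g m)) n)) => //.
    - by move=> m; apply: mdist (gW' m).
    - move=> m s; rewrite /dist le_min ler01 rnorm_ge0 /= /indic.
      have [Ds|Ds] := pselect (D s); first by rewrite mem_set// ge_min lexx.
      by rewrite memNset// f_0// zero_extN// subrr rnorm0 ge_min lexx orbT.
    - apply: filterS gf => s gf.
      apply: (squeeze_cvgr (f := cst 0) (h := fun m => rnorm S (g m s - f_ n s))).
      + apply: nearW => m; rewrite /dist le_min ler01 rnorm_ge0 /= ge_min.
        have [Ds|Ds] := pselect (D s); first by rewrite zero_extT// rnormC lexx orbT.
        by rewrite zero_extN// f_0// !subr0 rnorm0 rnorm_ge0 orbT.
      + exact: cvg_cst.
      + exact: (proj1 (cvg_rnormP S _ _) gf).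
  move=> /(fine_cvgP _ (0 : R))[fin /cvgrPdist_le /(_ (2^-1 ^+ n))].
  rewrite exprn_gt0 ?invr_gt0// => /(_ isT) le; have [m []] := filter_ex (filterI fin le).
  move=> fm; rewrite sub0r normrN /= => lem.
  exists (zero_ext D (g m), (fun D' => W m (D `&` D'))); split; first exact: gW'.
  by rewrite mul1r -(fineK fm) lee_fin (le_trans (ler_norm _)).
have [gW hgW] := choice near_step.
exists (fun n => (gW n).1), (fun n => (gW n).2); split; first by move=> n; have [] := hgW n.
have sum : {ae leb, forall s, cvgn (series (fun n => dist (gW n).1 n s))}.
  apply: (@ae_summable _ _ R leb (fun n => dist (gW n).1 n) 1).
  - by move=> n; have [st _] := hgW n; exact: mdist st.
  - by move=> n s; rewrite /dist le_min ler01 rnorm_ge0.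
  - by move=> n; have [_] := hgW n.
apply: filterS2 sum f_f => s /cvg_series_cvg_0 d0 /(cvg_rnormP S) f_f.
apply/(cvg_rnormP S)/cvgrPdistC_lt => e e0.
(* Below the threshold 1 the truncation is inactive, so the bound e/2 holds for the distance
   itself. *)
move: d0 => /cvgrPdistC_lt /(_ (Num.min 1 (e / 2))).
rewrite lt_min ltr01 divr_gt0// => /(_ isT) d0.
move: f_f => /cvgrPdistC_lt /(_ (e / 2)); rewrite divr_gt0// => /(_ isT) f_f.
near=> n; rewrite subr0 ger0_norm ?rnorm_ge0//.
have : `|rnorm S (f_ n s - f s) - 0| < e / 2 by near: n.
rewrite subr0 ger0_norm ?rnorm_ge0// => h1.
have : `|dist (gW n).1 n s - 0| < Num.min 1 (e / 2) by near: n.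
rewrite subr0 ger0_norm; last by rewrite /dist le_min ler01 rnorm_ge0.
rewrite /dist lt_min => /andP[]; rewrite !gt_min ltxx/= => h2.
move=> h3; have {h3} : rnorm S (f_ n s - (gW n).1 s) < e / 2.
  by case/orP: h3 => // /(lt_trans h2).
by rewrite rnormC; have := rnormBD S (f_ n s) ((gW n).1 s) (f s); lra.
Unshelve. all: by end_near.
Qed.

End DominatedLimit.

(** * Completeness of L^p *)

(** The power is differentiable only at positive points; the limit 0 is treated by inverting the
    power. *)
Lemma powR_cvg (R : realType) (I : Type) (F : set_system I) {FF : ProperFilter F}
    (u : I -> R) (l q : R) : 0 < q -> (forall i, 0 <= u i) -> u @ F --> l ->
  u i `^ q @[i --> F] --> l `^ q.
Proof.
move=> q0 u0 ul.
have l0 : 0 <= l by apply: (cvgr_to_ge ul); exact: nearW.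
have [l0'|l_gt0] := eqVneq l 0; last first.
  have lgt0 : 0 < l by rewrite lt_neqAle eq_sym l_gt0.
  apply: (continuous_cvg _ (h := fun x : R => x `^ q) _ ul).
  apply: differentiable_continuous.
  by apply/derivable1_diffP; apply: derivable_powR; rewrite in_itv/= lgt0.
rewrite l0' powR0 ?gt_eqF//; apply/cvgrPdistC_lt => e e0.
move: ul; rewrite l0' => /cvgrPdistC_lt /(_ (e `^ q^-1)); rewrite powR_gt0// => /(_ isT).
apply: filterS => i; rewrite !subr0 !ger0_norm ?powR_ge0// => h.
have -> : e = (e `^ q^-1) `^ q by rewrite -powRrM mulVf ?gt_eqF// powRr1// ltW.
by apply: gt0_ltr_powR => //; rewrite nnegrE ?powR_ge0.
Qed.

(** * Minkowski's inequality and Fatou's lemma for integrals of p-th powers *)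

Section PowerIntegral.
Context {d : measure_display} {T : measurableType d} {R : realType}.
Variable mu : {measure set T -> \bar R}.
Variable p : R.
Hypothesis p1 : 1 <= p.
Implicit Types a b : T -> R.

Let p0 : 0 < p. Proof. exact: lt_le_trans ltr01 p1. Qed.
Let p_neq0 : p != 0. Proof. by rewrite gt_eqF. Qed.

Definition pintegral a : \bar R := (\int[mu]_x (a x `^ p)%:E)%E.

Lemma pintegral_ge0 a : (0 <= pintegral a)%E.
Proof. by apply: integral_ge0 => x _; rewrite lee_fin powR_ge0. Qed.

Lemma le_pintegral a b : (forall x, 0 <= a x) -> (forall x, 0 <= b x) ->
  {ae mu, forall x, a x <= b x} -> (pintegral a <= pintegral b)%E.
Proof.
move=> a0 b0 ab; apply: ge0_ae_le_integral => [x|x|]; rewrite ?powR_ge0//.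
by apply: filterS ab => x ab; rewrite ge0_ler_powR// ?nnegrE// ltW.
Qed.

Lemma powRK (x : R) : 0 <= x -> (x `^ p^-1) `^ p = x.
Proof. by move=> x0; rewrite -powRrM mulVf// powRr1. Qed.

Lemma powRVK (x : R) : 0 <= x -> (x `^ p) `^ p^-1 = x.
Proof. by move=> x0; rewrite -powRrM divff// powRr1. Qed.

(** Passes between norms and root-free bounds of the form integral <= c^p. The latter make sense
    before finiteness is known and are the form used below. *)
Lemma pnorm_le a c : (pintegral a < +oo)%E -> 0 <= c ->
  (fine (pintegral a) `^ p^-1 <= c) = (pintegral a <= (c `^ p)%:E)%E.
Proof.
move=> afin c0; have af : pintegral a \is a fin_num.
  by rewrite ge0_fin_numE// pintegral_ge0.
rewrite -{2}(fineK af) lee_fin.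
have f0 : 0 <= fine (pintegral a) by rewrite fine_ge0// pintegral_ge0.
apply/idP/idP => h.
  rewrite -[leLHS]powRK//; apply: ge0_ler_powR => //; rewrite ?nnegrE ?powR_ge0//.
  exact: ltW.
rewrite -[leRHS]powRVK//; apply: ge0_ler_powR => //; rewrite ?nnegrE ?powR_ge0//.
by rewrite invr_ge0 ltW.
Qed.

Lemma pintegral_pnorm a : (pintegral a < +oo)%E ->
  pintegral a = ((fine (pintegral a) `^ p^-1) `^ p)%:E.
Proof.
move=> afin; have af : pintegral a \is a fin_num.
  by rewrite ge0_fin_numE// pintegral_ge0.
by rewrite powRK ?fineK// fine_ge0// pintegral_ge0.
Qed.

Lemma pintegralD a b : ae_measurable mu a -> ae_measurable mu b ->
  (forall x, 0 <= a x) -> (forall x, 0 <= b x) ->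
  (pintegral a < +oo)%E -> (pintegral b < +oo)%E ->
  (pintegral (fun x => (a x + b x)%R)
    <= ((fine (pintegral a) `^ p^-1 + fine (pintegral b) `^ p^-1) `^ p)%R%:E)%E.
Proof.
move=> ma mb a0 b0 afin bfin.
have [a' [ma' a'0 ea _]] := ae_measurable_ge0 ma a0.
have [b' [mb' b'0 eb _]] := ae_measurable_ge0 mb b0.
have normE f f' : (forall x, 0 <= f x) -> (forall x, 0 <= f' x) ->
    {ae mu, forall x, f x = f' x} ->
    ('N[mu]_p%:E[EFin \o f'] = pintegral f `^ p^-1)%E.
  move=> f0 f'0 e; rewrite unlock; congr (fun r => poweR r p^-1).
  transitivity (\int[mu]_x ((f' x `^ p)%R)%:E)%E.
    by apply: eq_integral => x _; rewrite /= ger0_norm.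
  apply: ge0_ae_eq_integral_fin => [x|x|]; rewrite ?powR_ge0//.
  by apply: filterS e => x ->.
have fin f : (pintegral f < +oo)%E ->
    (pintegral f `^ p^-1 = (fine (pintegral f) `^ p^-1)%:E)%E.
  move=> ffin; rewrite -poweR_EFin fineK// ge0_fin_numE//.
  exact: pintegral_ge0.
have := minkowski_EFin mu ma' mb' p1.
rewrite (normE a a')// (normE b b')// (normE (fun x => a x + b x) (a' \+ b')%R)//; last 3 first.
- by move=> x; rewrite addr_ge0.
- by move=> x; rewrite addr_ge0.
- by apply: filterS2 ea eb => x -> ->.
rewrite (fin _ afin) (fin _ bfin) -EFinD => h.
rewrite -poweR_EFin; apply: le_trans (gt0_ler_poweR (ltW p0) _ _ h).
- by rewrite -poweRrM mulVf// poweRe1// pintegral_ge0.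
- by rewrite in_itv/= poweR_ge0 leey.
- by rewrite in_itv/= lee_fin addr_ge0 ?powR_ge0// leey.
Qed.

Lemma pintegralZ a k : ae_measurable mu a -> 0 <= k -> (forall x, 0 <= a x) ->
  pintegral (fun x => k * a x) = ((k `^ p)%:E * pintegral a)%E.
Proof.
move=> ma k0 a0; rewrite /pintegral -ge0_ae_integralZl ?powR_ge0//; last 2 first.
- by apply: (ae_measurable_comp (h := fun x => x `^ p)) => //; exact: measurable_powR.
- by move=> x; rewrite powR_ge0.
by apply: eq_integral => x _; rewrite powRM.
Qed.

(** Fatou's lemma, applied after all functions are set to 0 on one null set, which makes them
    measurable and convergent everywhere. *)
Lemma pintegral_lim (a_ : nat -> T -> R) a (c : \bar R) :
  (forall n, ae_measurable mu (a_ n)) -> (forall n x, 0 <= a_ n x) ->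
  (forall x, 0 <= a x) -> {ae mu, forall x, a_ n x @[n --> \oo] --> a x} ->
  (\forall n \near \oo, pintegral (a_ n) <= c)%E -> (pintegral a <= c)%E.
Proof.
move=> ma_ a_0 a0 a_a ac.
have [a' ha'] := choice (fun n => ae_measurable_ge0 (ma_ n) (a_0 n)).
have ea : {ae mu, forall x n, a_ n x = a' n x}.
  have : mu.-negligible (\bigcup_n ~` [set x | a_ n x = a' n x]).
    by apply: negligible_bigcup => n; have [_ _] := ha' n.
  by apply: negligibleS => x /= /existsNP[n hn]; exists n.
have [N [mN N0 hN]] : {ae mu, forall x, (forall n, a_ n x = a' n x) /\
    a_ n x @[n --> \oo] --> a x} by apply: filterS2 ea a_a.
have mNC : measurable (~` N) by exact: measurableC.
have aeNC (f g : T -> R) : (forall x, ~ N x -> f x = g x) ->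
    {ae mu, forall x, f x = g x}.
  by move=> fg; exists N; split => // x /=; apply: contra_notP => /fg.
have Nconv x : ~ N x -> (forall n, a_ n x = a' n x) /\ a_ n x @[n --> \oo] --> a x.
  by move=> Nx; apply: contrapT => h; exact/Nx/hN.
pose b_ n x := a' n x * \1_(~` N) x; pose b x := a x * \1_(~` N) x.
have outN x : ~ N x -> \1_(~` N) x = 1 :> R by move=> Nx; rewrite /indic mem_set.
have inN x : N x -> \1_(~` N) x = 0 :> R by move=> Nx; rewrite /indic memNset// => /(_ Nx).
have a'0 n x : 0 <= a' n x by have [_ ->] := ha' n.
have b_0 n x : 0 <= b_ n x by rewrite mulr_ge0// /indic.
have b_b x : b_ n x @[n --> \oo] --> b x.
  rewrite /b_ /b; have [Nx|Nx] := pselect (N x).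
    by rewrite inN// mulr0; under eq_fun do rewrite mulr0; exact: cvg_cst.
  rewrite outN// mulr1; have [e] := Nconv x Nx.
  by under eq_fun do rewrite e; under [X in _ -> X @ _ --> _]eq_fun do rewrite mulr1.
have -> : pintegral a = pintegral b.
  apply: ge0_ae_eq_integral_fin => [x|x|]; rewrite ?powR_ge0//.
  by apply: aeNC => x Nx; rewrite /b outN// mulr1.
have eint n : pintegral (b_ n) = pintegral (a_ n).
  apply: ge0_ae_eq_integral_fin => [x|x|]; rewrite ?powR_ge0//.
  by apply: aeNC => x Nx; have [-> _] := Nconv x Nx; rewrite /b_ outN// mulr1.
have -> : pintegral b = (\int[mu]_x limn_einf (fun n => (b_ n x `^ p)%R%:E))%E.
  apply: eq_integral => x _.
  have : (b_ n x `^ p)%:E @[n --> \oo] --> (b x `^ p)%:E.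
    by apply: cvg_EFin; [exact: nearW|exact: powR_cvg].
  by move=> /cvg_limn_einf_sup[].
apply: le_trans (fatou _ _ _ _) _ => //.
- move=> n; apply/measurable_EFinP; have [ma' _ _ _] := ha' n.
  apply: (measurableT_comp (measurable_powR _)).
  by apply: measurable_funM => //; exact: measurable_indic.
- by move=> n x _; rewrite lee_fin powR_ge0.
rewrite limn_einf_lim; apply: lime_le; first exact: is_cvg_einfs.
have [m _ mc] := ac; exists m => // n /= mn; apply: le_trans (ereal_inf_lbound _) _.
  by exists n => /=.
by rewrite -/(pintegral _) eint; exact: mc.
Qed.

End PowerIntegral.

(** * L^p estimates and completeness on the line *)

Section LineLp.
Context {R : realType} {K : numFieldType} (S : scalars R K).
Local Notation leb := (@lebesgue_measure R).
Variable p : R.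
Hypothesis p1 : 1 <= p.
Implicit Types E : normedModType K.

Definition line_pintegral E (f : R -> E) : \bar R :=
  pintegral leb p (fun s => rnorm S (f s)).

Lemma line_pintegralD E (f g : R -> E) a b :
  line_measurable S f -> line_measurable S g -> 0 <= a -> 0 <= b ->
  (line_pintegral f <= (a `^ p)%:E)%E -> (line_pintegral g <= (b `^ p)%:E)%E ->
  (line_pintegral (fun s => (f s + g s)%R) <= ((a + b) `^ p)%R%:E)%E.
Proof.
move=> mf mg a0 b0 fa gb.
have ffin : (line_pintegral f < +oo)%E by rewrite (le_lt_trans fa)// ltry.
have gfin : (line_pintegral g < +oo)%E by rewrite (le_lt_trans gb)// ltry.
apply: (@le_trans _ _ (pintegral leb p (fun s => rnorm S (f s) + rnorm S (g s)))).
  apply: le_pintegral => // [s|s|]; rewrite ?addr_ge0 ?rnorm_ge0//.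
  by apply: aeW => s; exact: rnormD.
apply: le_trans (pintegralD p1 _ _ _ _ ffin gfin) _.
- exact: line_measurable_norm.
- exact: line_measurable_norm.
- by move=> s; exact: rnorm_ge0.
- by move=> s; exact: rnorm_ge0.
rewrite lee_fin; apply: ge0_ler_powR; rewrite ?nnegrE ?addr_ge0 ?powR_ge0//.
  exact: le_trans ler01 p1.
by apply: lerD; [rewrite (pnorm_le p1 ffin a0)|rewrite (pnorm_le p1 gfin b0)].
Qed.

(** Integrate x <= 1 + x^p on D for x = |f| / r, which replaces Hoelder's inequality: the result is
    r times (measure of D plus 1). *)
Lemma line_integral_norm_le E (D : set R) (f : R -> E) (r : R) :
  measurable D -> (leb D < +oo)%E -> line_measurable S f ->
  (forall s, ~ D s -> f s = 0) -> 0 < r -> (line_pintegral f <= (r `^ p)%:E)%E ->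
  (\int[leb]_s (rnorm S (f s))%:E <= ((fine (leb D) + 1) * r)%:E)%E.
Proof.
move=> mD Dfin mf f0 r0 fr.
have mnf := line_measurable_norm mf.
have n0 s : 0 <= rnorm S (f s) by exact: rnorm_ge0.
have rp0 : 0 < r `^ p by rewrite powR_gt0.
have r'0 : 0 <= r^-1 by rewrite invr_ge0 ltW.
have mnfp : ae_measurable leb (fun s => (r^-1 * rnorm S (f s)) `^ p).
  apply: (ae_measurable_comp (h := fun x => (r^-1 * x) `^ p)) => //.
  apply: (measurableT_comp (measurable_powR _)).
  by apply: measurable_funM => //; exact: measurable_id.
apply: (@le_trans _ _ (\int[leb]_s (r * (\1_D s + (r^-1 * rnorm S (f s)) `^ p))%R%:E)%E).
  apply: ge0_ae_le_integral => [s|s|]; rewrite ?rnorm_ge0//.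
    by rewrite mulr_ge0 ?(ltW r0)// addr_ge0 ?powR_ge0.
  apply: aeW => s; have -> : rnorm S (f s) = r * (r^-1 * rnorm S (f s)).
    by rewrite mulrA divff ?gt_eqF// mul1r.
  rewrite (mulrA r^-1) [r^-1 * r]mulVf ?gt_eqF// mul1r ler_pM2l//.
  set x := r^-1 * _; have x0 : 0 <= x by rewrite mulr_ge0.
  have [Ds|Ds] := pselect (D s); last first.
    by rewrite /x f0// rnorm0 mulr0 addr_ge0 ?powR_ge0.
  rewrite /indic mem_set//=; have [x1|x1] := leP x 1.
    by rewrite (le_trans x1)// lerDl powR_ge0.
  by rewrite (le_trans (le1r_powR (ltW x1) p1))// lerDr.
have mi : ae_measurable leb (\1_D : R -> R).
  by apply: ae_measurableP; exact: measurable_indic.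
rewrite ge0_ae_integralZl ?(ltW r0)//; last 2 first.
- exact: ae_measurableD.
- by move=> s; rewrite addr_ge0 ?powR_ge0.
rewrite ge0_ae_integralD//; last by move=> s; exact: powR_ge0.
rewrite integral_indic// setIT.
have -> : (\int[leb]_s ((r^-1 * rnorm S (f s)) `^ p)%:E =
    (r^-1 `^ p)%:E * line_pintegral f)%E by exact: pintegralZ.
have LE : leb D = (fine (leb D))%:E by rewrite fineK// ge0_fin_numE.
rewrite [X in (_ * (X + _))%E]LE.
rewrite [(_ + 1)%R * r]mulrC EFinM.
apply: (lee_wpmul2l (x := r%:E)); first by rewrite lee_fin ltW.
rewrite EFinD; apply: leeD => //.
apply: (@le_trans _ _ ((r^-1 `^ p)%:E * (r `^ p)%:E)%E).
  by apply: (lee_wpmul2l (x := (r^-1 `^ p)%:E)) => //; rewrite lee_fin powR_ge0.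
rewrite -EFinM lee_fin -powRM// ?(ltW r0)// mulVf ?gt_eqF//.
by rewrite powR1.
Qed.

(** The L^1 bounds make the series converge absolutely a.e.; Minkowski's inequality bounds its
    finite tails, and Fatou's lemma the infinite ones. *)
Lemma line_Lp_complete (E : completeNormedModType K) (D : set R) (w : nat -> R -> E) :
  measurable D -> (leb D < +oo)%E -> (forall k, line_measurable S (w k)) ->
  (forall k s, ~ D s -> w k s = 0) ->
  (forall k, line_pintegral (w k) <= ((2^-1 ^+ k) `^ p)%:E)%E ->
  exists f : R -> E, [/\ line_measurable S f, forall s, ~ D s -> f s = 0 &
    forall n, (line_pintegral (fun s => (f s - \sum_(0 <= k < n) w k s)%R)
      <= ((2 * 2^-1 ^+ n) `^ p)%R%:E)%E].
Proof.
move=> mD Dfin mw w0 wp.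
have h0 k : 0 < (2^-1 : R) ^+ k by rewrite exprn_gt0// invr_gt0.
(* Where the series diverges, on a null set, f takes whatever value [lim] returns. *)
pose f s := lim (series (w ^~ s) n @[n --> \oo]).
have wf : {ae leb, forall s, series (w ^~ s) n @[n --> \oo] --> f s}.
  have : {ae leb, forall s, cvgn (series (fun k => rnorm S (w k s)))}.
    apply: (@ae_summable _ _ R leb (fun k s => rnorm S (w k s)) (fine (leb D) + 1)).
    - by move=> n; exact: line_measurable_norm.
    - by move=> n s; exact: rnorm_ge0.
    - by move=> n; exact: (line_integral_norm_le mD Dfin (mw n) (w0 n) (h0 n) (wp n)).
  by apply: filterS => s /cvg_series_rnorm.
have msum n : line_measurable S (fun s => \sum_(0 <= k < n) w k s).
  exact: line_measurable_sum.
have sum0 n s : ~ D s -> \sum_(0 <= k < n) w k s = 0.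
  by move=> Ds; rewrite big1// => k _; exact: w0.
have mf : line_measurable S f.
  exact: (@line_measurable_lim _ _ S _ D (fun n s => \sum_(0 <= k < n) w k s)).
exists f; split => // [s Ds|n].
  rewrite /f (_ : series _ = cst 0); first exact: lim_cst.
  by apply/funext => n; exact: sum0.
have part j : (line_pintegral (fun s => (\sum_(n <= k < n + j) w k s)%R)
    <= ((2 * 2^-1 ^+ n * (1 - 2^-1 ^+ j)) `^ p)%R%:E)%E.
  elim: j => [|j IH].
    rewrite addn0 expr0 subrr mulr0 /line_pintegral /pintegral.
    under eq_integral do rewrite big_geq// rnorm0 powR0 ?gt_eqF ?(lt_le_trans ltr01 p1)//.
    by rewrite integral0 lee_fin powR_ge0.
  rewrite addnS.
  have -> : (fun s => \sum_(n <= k < (n + j).+1) w k s) =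
      (fun s => \sum_(n <= k < n + j) w k s + w (n + j)%N s).
    by apply/funext => s; rewrite big_nat_recr//= leq_addr.
  have -> : 2 * 2^-1 ^+ n * (1 - 2^-1 ^+ j.+1) =
      2 * 2^-1 ^+ n * (1 - 2^-1 ^+ j) + 2^-1 ^+ (n + j) :> R.
    by rewrite exprD exprS; lra.
  apply: line_pintegralD => //.
  - have -> : (fun s => \sum_(n <= k < n + j) w k s) =
        (fun s => \sum_(0 <= k < j) w (k + n)%N s).
      by apply/funext => s; rewrite -{1}[n]add0n big_addn addKn.
    by apply: line_measurable_sum => k.
  - rewrite mulr_ge0 ?mulr_ge0 ?(ltW (h0 _))// subr_ge0.
    by rewrite exprn_ile1// ?invr_ge0// invf_le1// ler1n.
apply: (@pintegral_lim _ _ _ leb p p1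
  (fun m s => rnorm S (\sum_(0 <= k < m) w k s - \sum_(0 <= k < n) w k s))).
- by move=> m; apply/line_measurable_norm/line_measurableB.
- by move=> m s; exact: rnorm_ge0.
- by move=> s; exact: rnorm_ge0.
- apply: filterS wf => s wf; apply: cvg_rnorm; apply: cvgB => //; exact: cvg_cst.
- exists n => // m /= nm.
  have -> : (fun s => rnorm S (\sum_(0 <= k < m) w k s - \sum_(0 <= k < n) w k s)) =
      (fun s => rnorm S (\sum_(n <= k < n + (m - n)) w k s)).
    apply/funext => s; rewrite subnKC//; congr (rnorm S _).
    by rewrite (big_cat_nat (leq0n n) nm)/= addrAC subrr add0r.
  apply: le_trans (part _) _; rewrite lee_fin; apply: ge0_ler_powR.
  - exact: le_trans ler01 p1.
  - rewrite nnegrE mulr_ge0 ?mulr_ge0 ?(ltW (h0 _))// subr_ge0.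
    by rewrite exprn_ile1// ?invr_ge0// invf_le1// ler1n.
  - by rewrite nnegrE mulr_ge0// ltW.
  - by apply: ler_piMr; [rewrite mulr_ge0// ltW|rewrite lerBlDr lerDl ltW].
Qed.

End LineLp.

(** * L^p on an interval: linear operations, completeness, restriction and shifts *)

Section LpInterval.
Context {R : realType} {K : numFieldType} (S : scalars R K).
Local Notation leb := (@lebesgue_measure R).
Variable p : R.
Hypothesis p1 : 1 <= p.
Implicit Types E : normedModType K.

Let p0 : 0 < p. Proof. exact: lt_le_trans ltr01 p1. Qed.
Let p_neq0 : p != 0. Proof. by rewrite gt_eqF. Qed.

Lemma lebesgue_measure_oo_lty (a b : R) : (leb `]a, b[ < +oo)%E.
Proof. by rewrite lebesgue_measure_itv/=; case: ifP => // _; rewrite -EFinD ltry. Qed.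

Lemma in_LpP E t (u : R -> E) : in_Lp S p t u <->
  line_measurable S (zero_ext `]0%R, t[ u) /\
  (line_pintegral S p (zero_ext `]0%R, t[ u) < +oo)%E.
Proof.
have sm := strongly_measurable_line S u (measurable_itv _) (lebesgue_measure_oo_lty 0 t).
have e := integral_zero_ext S `]0%R, t[ u (h := fun x => x `^ p) (powR0 p_neq0).
by rewrite /in_Lp e; split=> -[mu ufin]; split; [exact/sm|exact: ufin|exact/sm|exact: ufin].
Qed.

Lemma Lp_normE E t (u : R -> E) :
  Lp_norm S p t u = fine (line_pintegral S p (zero_ext `]0%R, t[ u)) `^ p^-1.
Proof.
by rewrite /Lp_norm (integral_zero_ext S _ u (h := fun x => x `^ p)) ?powR0.
Qed.

Lemma Lp_norm_ge0 E t (u : R -> E) : 0 <= Lp_norm S p t u.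
Proof. exact: powR_ge0. Qed.

Lemma Lp_norm_le E t (u : R -> E) c : in_Lp S p t u -> 0 <= c ->
  (Lp_norm S p t u <= c) =
  (line_pintegral S p (zero_ext `]0%R, t[ u) <= (c `^ p)%:E)%E.
Proof. by move=> /in_LpP[_ ufin] c0; rewrite Lp_normE pnorm_le. Qed.

Lemma line_pintegral_Lp E t (u : R -> E) : in_Lp S p t u ->
  line_pintegral S p (zero_ext `]0%R, t[ u) = (Lp_norm S p t u `^ p)%:E.
Proof. by move=> /in_LpP[_ ufin]; rewrite Lp_normE; exact: pintegral_pnorm. Qed.

(** Common pattern of the closure properties below: identify the zero extension, bound its
    p-integral by c^p, and obtain membership and norm bound together. *)
Lemma in_Lp_le E t (u : R -> E) (f : R -> E) c : zero_ext `]0%R, t[ u = f ->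
  line_measurable S f -> 0 <= c -> (line_pintegral S p f <= (c `^ p)%:E)%E ->
  in_Lp S p t u /\ Lp_norm S p t u <= c.
Proof.
move=> <- mf c0 fc; have Lu : in_Lp S p t u.
  by apply/in_LpP; split => //; rewrite (le_lt_trans fc)// ltry.
by split => //; rewrite Lp_norm_le.
Qed.

Lemma in_LpD E t (u w : R -> E) : in_Lp S p t u -> in_Lp S p t w ->
  in_Lp S p t (u + w) /\ Lp_norm S p t (u + w) <= Lp_norm S p t u + Lp_norm S p t w.
Proof.
move=> Lu Lw; have [mu _] := (in_LpP _ _).1 Lu; have [mw _] := (in_LpP _ _).1 Lw.
apply: (@in_Lp_le _ _ _ (fun s => zero_ext `]0%R, t[ u s + zero_ext `]0%R, t[ w s)).
- by apply/funext => s; rewrite /zero_ext; case: ifP => // _; rewrite addr0.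
- exact: line_measurableD.
- by rewrite addr_ge0// Lp_norm_ge0.
- by apply: line_pintegralD; rewrite ?Lp_norm_ge0 ?line_pintegral_Lp.
Qed.

Lemma in_LpZ E t (k : R) (u : R -> E) : in_Lp S p t u ->
  in_Lp S p t (ofR S k *: u) /\ Lp_norm S p t (ofR S k *: u) = `|k| * Lp_norm S p t u.
Proof.
have scale (a : R) (v : R -> E) : in_Lp S p t v ->
    in_Lp S p t (ofR S a *: v) /\ Lp_norm S p t (ofR S a *: v) <= `|a| * Lp_norm S p t v.
  move=> Lv; have [mv _] := (in_LpP _ _).1 Lv.
  apply: (@in_Lp_le _ _ _ (fun s => ofR S a *: zero_ext `]0%R, t[ v s)).
  - by apply/funext => s; rewrite /zero_ext; case: ifP => // _; rewrite scaler0.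
  - exact: line_measurableZ.
  - by rewrite mulr_ge0// Lp_norm_ge0.
  - rewrite /line_pintegral.
    under [X in pintegral _ _ X]eq_fun do rewrite rnormZ.
    rewrite pintegralZ//; last 2 first.
    + exact: line_measurable_norm.
    + by move=> s; exact: rnorm_ge0.
    have := line_pintegral_Lp Lv; rewrite /line_pintegral => ->.
    by rewrite -EFinM powRM// Lp_norm_ge0.
move=> Lu; have [Lku kule] := scale k u Lu; split => //.
apply/eqP; rewrite eq_le kule /=; have [->|k0] := eqVneq k 0.
  by rewrite normr0 mul0r Lp_norm_ge0.
(* Scaling back by the inverse of k gives the reverse inequality. *)
have [_] := scale k^-1 _ Lku.
rewrite scalerA -rmorphM mulVf// rmorph1 scale1r normrV ?unitfE//.
by rewrite ler_pdivlMl ?normr_gt0.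
Qed.

Lemma in_Lp0 E t : in_Lp S p t (0 : R -> E) /\ Lp_norm S p t (0 : R -> E) = 0.
Proof.
have [||//||h h'] := @in_Lp_le E t 0 (fun=> 0) 0.
- by apply/funext => s; rewrite /zero_ext; case: ifP.
- exact: step_line_measurable (step_function0 _).
- rewrite /line_pintegral /pintegral.
  under eq_integral do rewrite rnorm0 powR0//.
  by rewrite integral0 powR0.
by split => //; apply/eqP; rewrite eq_le h' Lp_norm_ge0.
Qed.

Lemma Lp_complete (E : completeNormedModType K) t (w : nat -> R -> E) :
  (forall k, in_Lp S p t (w k) /\ Lp_norm S p t (w k) <= 2^-1 ^+ k) ->
  exists2 f, in_Lp S p t f &
    forall n, Lp_norm S p t (f - series w n) <= 2 * 2^-1 ^+ n.
Proof.
move=> hw; have h0 k : 0 <= (2^-1 : R) ^+ k by rewrite exprn_ge0// invr_ge0.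
have [||||f [mf f0 fw]] := @line_Lp_complete R K S p p1 E `]0%R, t[%classic
  (fun k => zero_ext `]0%R, t[ (w k)) _ (lebesgue_measure_oo_lty 0 t).
- by [].
- by move=> k; have [/in_LpP[]] := hw k.
- by move=> k s Ds; rewrite zero_extN.
- by move=> k; have [Lw] := hw k; rewrite Lp_norm_le.
have fE : zero_ext `]0%R, t[ f = f.
  apply/funext => s; have [Ds|Ds] := pselect (`]0%R, t[%classic s).
    by rewrite zero_extT.
  by rewrite zero_extN// f0.
have sE n : zero_ext `]0%R, t[ (f - series w n) =
    (fun s => f s - \sum_(0 <= k < n) zero_ext `]0%R, t[ (w k) s).
  apply/funext => s; have [Ds|Ds] := pselect (`]0%R, t[%classic s).
    rewrite zero_extT// /series/= !fctE fct_sumE; congr (_ - _).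
    by apply: eq_bigr => k _; rewrite zero_extT.
  by rewrite zero_extN// f0// big1 ?subr0// => k _; rewrite zero_extN.
have mn n : line_measurable S (fun s => f s - \sum_(0 <= k < n) zero_ext `]0%R, t[ (w k) s).
  apply: line_measurableB => //; apply: line_measurable_sum => k.
  by have [/in_LpP[]] := hw k.
have Lfn n : Lp_norm S p t (f - series w n) <= 2 * 2^-1 ^+ n.
  by have [] := in_Lp_le (sE n) (mn n) (mulr_ge0 (ler0n _ 2) (h0 n)) (fw n).
exists f => //.
(* The tail bound at n = 0 concerns f itself and shows that it lies in L^p. *)
have [] := @in_Lp_le _ t f (zero_ext `]0%R, t[ f) 2 erefl.
- by rewrite fE.
- by [].
- have e : (fun s => f s - \sum_(0 <= k < 0) zero_ext `]0%R, t[ (w k) s) = f.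
    by apply/funext => s; rewrite big_geq// subr0.
  by have := fw 0%N; rewrite e fE expr0 mulr1.
by [].
Qed.

Lemma integral_norm_Lp E t (u : R -> E) (r : R) : in_Lp S p t u -> 0 < r ->
  Lp_norm S p t u <= r ->
  (\int[leb]_s (rnorm S (zero_ext `]0%R, t[ u s))%:E
     <= ((fine (leb `]0%R, t[) + 1) * r)%:E)%E.
Proof.
move=> Lu r0; rewrite Lp_norm_le ?(ltW r0)// => ur.
apply: line_integral_norm_le ur => //; first exact: lebesgue_measure_oo_lty.
  by have [] := (in_LpP _ _).1 Lu.
by move=> s Ds; rewrite zero_extN.
Qed.

Lemma in_Lp_restrict E t a (u : R -> E) : in_Lp S p t u -> a <= t ->
  in_Lp S p a u /\ Lp_norm S p a u <= Lp_norm S p t u.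
Proof.
move=> Lu at_; have [mu ufin] := (in_LpP _ _).1 Lu.
apply: (@in_Lp_le _ _ _ (zero_ext `]0%R, a[ (zero_ext `]0%R, t[ u))).
- apply/funext => s; have [Ds|Ds] := pselect (`]0%R, a[%classic s).
    rewrite !zero_extT//; move: Ds; rewrite /= !in_itv/= => /andP[-> /lt_le_trans]; exact.
  by rewrite !zero_extN.
- exact: line_measurable_restrict.
- exact: Lp_norm_ge0.
- rewrite -(line_pintegral_Lp Lu); apply: le_pintegral => // [s|s|].
  + exact: rnorm_ge0.
  + exact: rnorm_ge0.
  + apply: aeW => s; rewrite {1}/zero_ext; case: ifP => // _.
    by rewrite rnorm0 rnorm_ge0.
Qed.

Lemma in_Lp_shift E t a b (u w : R -> E) : in_Lp S p t u ->
  0 <= a -> a + b <= t ->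
  (forall s, 0 < s -> s < b -> w s = u (s + a)) ->
  in_Lp S p b w /\ Lp_norm S p b w <= Lp_norm S p t u.
Proof.
move=> Lu a0 abt wu; have [mu ufin] := (in_LpP _ _).1 Lu.
apply: (@in_Lp_le _ _ _ (zero_ext `]0%R, b[ (fun s => zero_ext `]0%R, t[ u (s + a)))).
- apply/funext => s; have [Ds|Ds] := pselect (`]0%R, b[%classic s); last by rewrite !zero_extN.
  have /andP[s0 sb] : 0 < s < b by move: Ds; rewrite /= in_itv.
  by rewrite !zero_extT//= ?in_itv/= ?wu//; apply/andP; split; lra.
- by apply: line_measurable_restrict => //; exact: (line_measurable_shift a mu).
- exact: Lp_norm_ge0.
- rewrite -(line_pintegral_Lp Lu).
  have -> : line_pintegral S p (zero_ext `]0%R, t[ u) =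
      line_pintegral S p (fun s => zero_ext `]0%R, t[ u (s + a)).
    rewrite /line_pintegral /pintegral.
    rewrite (@ge0_integral_shift _ a (fun s => rnorm S (zero_ext `]0%R, t[ u s) `^ p))//.
      apply: (ae_measurable_comp (h := fun x => x `^ p)).
        exact: measurable_powR.
      exact: line_measurable_norm.
    by move=> s; exact: powR_ge0.
  apply: le_pintegral => // [s|s|].
  + exact: rnorm_ge0.
  + exact: rnorm_ge0.
  + apply: aeW => s; rewrite {1}/zero_ext; case: ifP => // _.
    by rewrite rnorm0 rnorm_ge0.
Qed.

(** Delaying u by b - t lets an input on a short interval be treated as one on an interval of
    prescribed length b. *)
Lemma in_Lp_delay E t b (u : R -> E) : in_Lp S p t u -> 0 <= t -> t <= b ->
  let v s := if s <= b - t then 0 else u (s - (b - t)) in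
  in_Lp S p b v /\ Lp_norm S p b v <= Lp_norm S p t u.
Proof.
move=> Lu t0 tb v; have [mu ufin] := (in_LpP _ _).1 Lu.
apply: (@in_Lp_le _ _ _ (fun s => zero_ext `]0%R, t[ u (s - (b - t)))).
- apply/funext => s; have [sb|bs] := leP s (b - t).
    rewrite [RHS]zero_extN; last first.
      by rewrite /= in_itv/= => /andP[]; rewrite subr_gt0 ltNge sb.
    by rewrite /zero_ext /v sb; case: ifP.
  have [sb'|sb'] := ltP s b.
    rewrite !zero_extT/= ?in_itv/= /v; first by rewrite leNgt bs.
      by apply/andP; split; lra.
    by apply/andP; split; lra.
  by rewrite !zero_extN//= in_itv/= => /andP[]; lra.
- exact: (line_measurable_shift (- (b - t)) mu).
- exact: Lp_norm_ge0.
- rewrite -(line_pintegral_Lp Lu) /line_pintegral /pintegral.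
  rewrite (@ge0_integral_shift _ (- (b - t)) (fun s => rnorm S (zero_ext `]0%R, t[ u s) `^ p))//.
    apply: (ae_measurable_comp (h := fun x => x `^ p)).
      exact: measurable_powR.
    exact: line_measurable_norm.
  by move=> s; exact: powR_ge0.
Qed.

End LpInterval.

(** * The semigroup on the extrapolation space *)

Section Semigroup.
Context {R : realType} {K : numFieldType} (S : scalars R K).

Section Extrapolation.
Context {X Xm1 : completeNormedModType K} (A : unbounded_op X)
  (T : R -> {linear X -> X}) (J : {linear X -> Xm1}) (Tm1 : R -> {linear Xm1 -> Xm1}).
Hypothesis hA : generates S A T.
Hypothesis hX : is_extrapolation_space S A J.
Hypothesis hT : is_extended_semigroup S J T Tm1.

Lemma extrapolation_injective : injective J.
Proof.
have [beta [Q [[_ resQ _] JQ _]]] := hX.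
move=> x y Jxy; apply/subr0_eq; set z := x - y.
have Qz : Q z = 0.
  by apply/normr0_eq0; rewrite -JQ linearB Jxy subrr normr0.
(* [A] is a bare map, so A 0 = 0 is not at hand; but Q z = Q 0 = 0, and the resolvent equations at z
   and at 0 then have the same left side. *)
have [_ <-] := resQ z; have [_ <-] := resQ 0.
by rewrite Qz linear0.
Qed.

Lemma extrapolation_bounded : bounded_op S J.
Proof.
have [beta [Q [[[M hM] _ _] JQ _]]] := hX.
by exists M => x; rewrite (le_trans _ (hM x))// rnorm_le JQ.
Qed.

(** T(t) is continuous and passes through the difference quotient, so it preserves the domain of A
    and commutes with A there. Applying Q to (beta - A) T(t) Q x = T(t) x gives the claim. *)
Lemma resolvent_commutes beta (Q : {linear X -> X}) t x :
  is_resolvent S A beta Q -> 0 <= t -> Q (T t x) = T t (Q x).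
Proof.
move=> [_ resQ Qres] t0; have [[Tb T0 TD _] domA] := hA.
have [dQx Qx] := resQ x.
have [dTQ ATQ] : dom A (T t (Q x)) /\ A (T t (Q x)) = T t (A (Q x)).
  apply/domA; have /domA h := conj dQx (erefl (A (Q x))).
  apply: cvg_trans (bounded_op_cvg (Tb t t0) h); apply: near_eq_cvg.
  near=> h0; have hp : 0 <= h0 by apply/ltW; near: h0; exact: nbhs_right_gt.
  by rewrite linearZ linearB/= -!TD// [t + h0]addrC.
by rewrite -{1}Qx linearB linearZ/= -ATQ Qres.
Unshelve. all: by end_near.
Qed.

(** On the range of J the norm is |Q x| and Q commutes with T(t), so the same constants work.
    Density and continuity of [Tm1 t] do the rest. *)
Lemma extended_semigroup_bound M w : 0 <= M ->
  (forall t x, 0 <= t -> rnorm S (T t x) <= M * expR (- (w * t)) * rnorm S x) ->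
  forall t z, 0 <= t -> rnorm S (Tm1 t z) <= M * expR (- (w * t)) * rnorm S z.
Proof.
move=> M0 hM t z t0; have [[Tm1b _ _ _] Tm1J] := hT.
have [beta [Q [resQ JQ dJ]]] := hX.
set c := M * expR (- (w * t)).
have c0 : 0 <= c by rewrite mulr_ge0// expR_ge0.
have JE x : rnorm S (J x) = rnorm S (Q x) by apply/eqP; rewrite eq_le !rnorm_le JQ lexx.
have onJ x : rnorm S (Tm1 t (J x)) <= c * rnorm S (J x).
  by rewrite Tm1J// !JE (resolvent_commutes _ resQ)// hM.
have [C hC] := Tm1b t t0.
apply/ler_addgt0Pr => e e0.
(* Replacing z by a point at distance delta costs at most (|C| + c) delta; the 1 keeps the
   denominator positive. *)
have d0 : 0 < `|C| + c + 1 by rewrite ltr_wpDl// addr_ge0.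
have [y [/= zx [x _ Jx]]] : (ball z (ofR S (e / (`|C| + c + 1))) `&` range J) !=set0.
  apply: dJ; last exact: ball_open.
  by exists z; apply: ballxx; rewrite -(rmorph0 (ofR S)) ofR_lt divr_gt0.
move: zx; rewrite -ball_normE /ball_/= -(ofR_rnorm S) ofR_lt.
have {Jx} Jx := esym Jx; rewrite ltr_pdivlMr// => h.
have h1 : rnorm S (Tm1 t z) <= rnorm S (Tm1 t (z - y)) + rnorm S (Tm1 t y).
  have -> : Tm1 t z = Tm1 t (z - y) + Tm1 t y by rewrite -linearD subrK.
  exact: rnormD.
have h2 : rnorm S (Tm1 t (z - y)) <= `|C| * rnorm S (z - y).
  by rewrite (le_trans (hC _))// ler_wpM2r ?rnorm_ge0// ler_norm.
have h3 : rnorm S y <= rnorm S (z - y) + rnorm S z.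
  by rewrite -{1}(subKr z y) [_ + rnorm S z]addrC rnormB.
have h4 := ler_wpM2l c0 h3; have h5 := onJ x.
have h6 : 0 <= rnorm S (z - y) by exact: rnorm_ge0.
by rewrite -Jx in h5; nra.
Qed.

End Extrapolation.

(** * Exponential decay from a KL bound *)

Section Decay.
Context {X : normedModType K} (T : R -> {linear X -> X}).
Hypothesis hT : C0_semigroup S T.

Lemma exponentially_stable_KL (b : R -> R -> R) : class_KL b ->
  (forall t x, 0 <= t -> rnorm S (T t x) <= b (rnorm S x) t) ->
  exponentially_stable S T.
Proof.
move=> [_ bL] Tb; have [_ T0 TD _] := hT.
have [_ bdec blim b0] := bL 1 ltr01.
have Tb1 t x : 0 <= t -> rnorm S (T t x) <= b 1 t * rnorm S x.
  move=> t0; have [x0|x0] := eqVneq (rnorm S x) 0.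
    by rewrite (rnorm_eq0 x0) linear0 !rnorm0 mulr0.
  have xp : 0 < rnorm S x by rewrite lt_neqAle eq_sym x0 rnorm_ge0.
  have := Tb t (ofR S (rnorm S x)^-1 *: x) t0.
  rewrite linearZ !rnormZ ger0_norm ?invr_ge0 ?rnorm_ge0// mulVf//.
  by rewrite ler_pdivrMl// mulrC.
have [tau tau0 btau] : exists2 tau, 0 < tau & b 1 tau <= 2^-1.
  have h : \forall t \near +oo, 0 < t /\ b 1 t <= 2^-1.
    near=> t; split; first by near: t; exact: nbhs_pinfty_gt.
    have : `|b 1 t - 0| < 2^-1.
      by near: t; move/cvgrPdistC_lt : blim; apply; rewrite invr_gt0.
    by rewrite subr0 => /ltW; exact: le_trans (ler_norm _).
  by have [t []] := filter_ex h; exists t.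
(* n steps of length tau give 2^-n; the remaining time t is controlled by monotonicity, b(1,t) <=
   b(1,0). *)
have iter n t x : 0 <= t -> rnorm S (T (t + n%:R * tau) x) <= 2^-1 ^+ n * b 1 0 * rnorm S x.
  move=> t0; elim: n => [|n IH].
    rewrite mul0r addr0 expr0 mul1r (le_trans (Tb1 t x t0))//.
    rewrite ler_wpM2r ?rnorm_ge0//; have [->//|tn0] := eqVneq t 0.
    by rewrite ltW// bdec// lt_neqAle eq_sym tn0.
  have -> : t + n.+1%:R * tau = tau + (t + n%:R * tau) by rewrite -natr1; lra.
  rewrite TD ?(ltW tau0)//; last by rewrite addr_ge0// mulr_ge0// ltW.
  apply: le_trans (Tb1 _ _ (ltW tau0)) _; rewrite exprS.
  apply: (@le_trans _ _ (2^-1 * rnorm S (T (t + n%:R * tau) x))).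
    by rewrite ler_wpM2r ?rnorm_ge0.
  by rewrite -!mulrA ler_pM2l ?invr_gt0// !mulrA.
(* The rate turns 2^-(t/tau) into an exponential, the factor 2 pays for rounding t / tau down to n,
   and the 1 makes the constant positive. *)
exists (2 * (b 1 0 + 1)), (ln 2 / tau); have b10 : 0 <= b 1 0 by exact: b0.
split; first by rewrite mulr_gt0// ltr_wpDl.
  by rewrite divr_gt0// ln_gt0// ltr1n.
move=> t x t0; set n := Num.truncn (t / tau).
have tt0 : 0 <= t / tau by rewrite divr_ge0// ltW.
have /andP[nt tn] : n%:R <= t / tau < n.+1%:R by exact: truncn_itv.
have -> : t = (t - n%:R * tau) + n%:R * tau by rewrite subrK.
have r0 : 0 <= t - n%:R * tau by rewrite subr_ge0 -ler_pdivlMr.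
apply: le_trans (iter n _ x r0) _; rewrite subrK ler_wpM2r ?rnorm_ge0//.
have : 2^-1 ^+ n <= 2 * expR (- (ln 2 / tau * t)) :> R.
  have -> : (2^-1 : R) = expR (- ln 2) by rewrite expRN lnK// posrE.
  rewrite -expRM_natl -[X in _ <= X * _]lnK ?posrE// -expRD ler_expR.
  have ln0 : 0 < ln 2 :> R by rewrite ln_gt0// ltr1n.
  have : ln 2 * (t / tau) < ln 2 * n.+1%:R by rewrite ltr_pM2l.
  by rewrite -natr1; lra.
have : 0 <= expR (- (ln 2 / tau * t)) by exact: expR_ge0.
have : 0 <= (2^-1 : R) ^+ n by rewrite exprn_ge0// invr_ge0.
by move=> ? ? ?; nra.
Unshelve. all: by end_near.
Qed.

End Decay.
End Semigroup.

(** * Admissibility of the input operator *)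

Section Admissibility.
Context {R : realType} {K : numFieldType} (S : scalars R K)
  {X U Xm1 : completeNormedModType K} (J : {linear X -> Xm1})
  (Tm1 : R -> {linear Xm1 -> Xm1}) (T : R -> {linear X -> X})
  (B : {linear U -> Xm1}) (p M w MB : R).
Hypothesis p1 : 1 <= p.
Hypothesis J_inj : injective J.
Hypothesis J_bounded : bounded_op S J.
Hypothesis hT : is_extended_semigroup S J T Tm1.
Hypothesis M_gt0 : 0 < M.
Hypothesis w_gt0 : 0 < w.
Hypothesis T_le : forall t x, 0 <= t ->
  rnorm S (T t x) <= M * expR (- (w * t)) * rnorm S x.
Hypothesis Tm1_le : forall t z, 0 <= t ->
  rnorm S (Tm1 t z) <= M * expR (- (w * t)) * rnorm S z.
Hypothesis B_le : forall v, rnorm S (B v) <= MB * rnorm S v.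
Local Notation leb := (@lebesgue_measure R).

(** A relation rather than a function: the integral is formed in X_{-1}, and that it comes from X is
    the assumption [reach]. *)
Definition input_to_state t (u : R -> U) (x : X) : Prop :=
  is_bochner_integral S `]0%R, t[%classic (fun s => Tm1 (t - s) (B (u s))) (J x).

Hypothesis reach : forall t u, 0 <= t -> in_Lp S p t u ->
  exists x, input_to_state t u x.

Let F t (u : R -> U) := zero_ext `]0%R, t[ (fun s => Tm1 (t - s) (B (u s))).

Lemma input_to_state_line t u x : input_to_state t u x -> line_integral S (F t u) (J x).
Proof. by apply: bochner_line_integral => //; exact: lebesgue_measure_oo_lty. Qed.

Lemma input_to_stateD t u v x y z : input_to_state t u x -> input_to_state t v y ->
  input_to_state t (u + v) z -> z = x + y.
Proof.
move=> /input_to_state_line hx /input_to_state_line hy /input_to_state_line hz.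
apply: J_inj; rewrite linearD; apply: (line_integral_unique hz (line_integralD hx hy)).
apply: aeW => s; rewrite /F /zero_ext; case: ifP => _; last by rewrite addr0.
by rewrite -!linearD.
Qed.

Lemma input_to_stateZ t u x y (k : R) : input_to_state t u x ->
  input_to_state t (ofR S k *: u) y -> y = ofR S k *: x.
Proof.
move=> /input_to_state_line hx /input_to_state_line hy.
apply: J_inj; rewrite linearZ; apply: (line_integral_unique hy (line_integralZ k hx)).
apply: aeW => s; rewrite /F /zero_ext; case: ifP => _; last by rewrite scaler0.
by rewrite -!linearZ.
Qed.

Lemma input_to_state_unique t u x y :
  input_to_state t u x -> input_to_state t u y -> x = y.
Proof.
move=> /input_to_state_line hx /input_to_state_line hy.
by apply/J_inj/(line_integral_unique hx hy)/aeW.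
Qed.

(** Continuity of the input-to-state map into X_{-1}: the integrand is bounded by a multiple of |u|,
    and on a bounded interval L^p embeds into L^1. *)
Lemma input_to_state_weak_bound t u x : 0 <= t -> in_Lp S p t u ->
  input_to_state t u x ->
  rnorm S (J x) <= M * `|MB| * (fine (leb `]0%R, t[) + 1) * Lp_norm S p t u.
Proof.
move=> t0 Lu /input_to_state_line/line_integral_le hx.
set L := fine _ + 1; have L_gt0 : 0 < L by rewrite ltr_wpDl// fine_ge0.
set C := M * `|MB|; have C0 : 0 <= C by rewrite mulr_ge0// ltW.
(* The L^1 estimate divides by r, so the norm of u, possibly 0, is approached from above. *)
suff main r : 0 < r -> Lp_norm S p t u <= r -> rnorm S (J x) <= C * L * r.
  have D0 : 0 < C * L + 1 by rewrite ltr_wpDl// mulr_ge0// ltW.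
  apply/ler_addgt0Pr => e e0; have e'0 : 0 < e / (C * L + 1) by rewrite divr_gt0.
  have := main (Lp_norm S p t u + e / (C * L + 1)).
  rewrite ltr_wpDl ?Lp_norm_ge0// lerDl (ltW e'0) => /(_ isT isT) /le_trans; apply.
  rewrite mulrDr lerD2l mulrA ler_pdivrMr// mulrC ler_pM2l//.
  by rewrite lerDl.
move=> r0 ur; rewrite -lee_fin; apply: le_trans hx _.
have [mu _] := (in_LpP S p1 t u).1 Lu.
apply: (@le_trans _ _ (\int[leb]_s (C * rnorm S (zero_ext `]0%R, t[ u s))%R%:E)%E).
  apply: ge0_ae_le_integral => [s|s|].
  - exact: rnorm_ge0.
  - by rewrite mulr_ge0 ?rnorm_ge0.
  apply: aeW => s; have [Ds|Ds] := pselect (`]0%R, t[%classic s); last first.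
    by rewrite /F zero_extN// rnorm0 mulr_ge0 ?rnorm_ge0.
  rewrite /F !zero_extT//; move: Ds; rewrite /= in_itv/= => /andP[s0 st].
  have ts : 0 <= t - s by rewrite subr_ge0 ltW.
  apply: le_trans (Tm1_le _ ts) _; rewrite /C -!mulrA ler_pM2l//.
  apply: (@le_trans _ _ (rnorm S (B (u s)))).
    by rewrite ler_piMl ?rnorm_ge0// -expR0 ler_expR oppr_le0 mulr_ge0// ltW.
  by rewrite (le_trans (B_le _))// ler_wpM2r ?rnorm_ge0// ler_norm.
rewrite ge0_ae_integralZl//; last 2 first.
- exact: line_measurable_norm.
- by move=> s; exact: rnorm_ge0.
rewrite -mulrA (EFinM C); apply: (lee_wpmul2l (x := C%:E)); first by rewrite lee_fin.
exact: (integral_norm_Lp p1 Lu r0 ur).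
Qed.

(** Before time a the semigroup law pulls T_{-1}(b) out of the integrand; after a what remains is
    the integrand of y shifted by a. *)
Lemma input_to_state_concat a b u v x y z : 0 <= a -> 0 <= b ->
  (forall s, 0 < s -> s < b -> v s = u (s + a)) ->
  input_to_state a u x -> input_to_state b v y -> input_to_state (a + b) u z ->
  z = T b x + y.
Proof.
move=> a0 b0 vu /input_to_state_line hx /input_to_state_line hy /input_to_state_line hz.
have [[Tm1b Tm10 Tm1D _] Tm1J] := hT.
apply: J_inj; rewrite linearD -Tm1J//.
apply: (line_integral_unique hz (line_integralD
  (line_integral_map (Tm1b b b0) hx) (line_integral_shift (- a) hy))).
(* The intervals are open, so at s = a both pieces vanish while the integrand of z need not. *)
exists [set a]; split => //; first exact: lebesgue_measure_set1.
move=> s /=; apply: contra_notP => sa; rewrite /F.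
have [s0|s0] := leP s 0.
  rewrite !zero_extN ?linear0 ?addr0// /= in_itv/=; apply/negP; rewrite negb_and -!leNgt.
  - by rewrite subr_le0 (le_trans s0 a0).
  - by rewrite s0.
  - by rewrite s0.
have [sb|sb] := leP (a + b) s.
  rewrite !zero_extN ?linear0 ?addr0// /= in_itv/=; apply/negP; rewrite negb_and -!leNgt.
  - by apply/orP; right; lra.
  - by apply/orP; right; lra.
  - by rewrite sb orbT.
rewrite zero_extT; last by rewrite /= in_itv/= s0.
have [sa'|sa'] := ltP s a.
  rewrite zero_extT; last by rewrite /= in_itv/= s0.
  rewrite zero_extN ?addr0; last first.
    by rewrite /= in_itv/= => /andP[]; rewrite subr_gt0 ltNge ltW.
  rewrite -Tm1D ?subr_ge0 ?(ltW sa')//.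
  by rewrite addrCA addrA.
have as_ : a < s by rewrite lt_neqAle sa' andbT; apply/eqP => h; exact/sa/esym.
rewrite zero_extN ?linear0 ?add0r; last first.
  by rewrite /= in_itv/= => /andP[_]; rewrite ltNge sa'.
rewrite zero_extT; last by rewrite /= in_itv/= subr_gt0 as_/=; lra.
rewrite vu ?subrK//; last 2 first.
- by rewrite subr_gt0.
- by lra.
by congr (Tm1 _ _); lra.
Qed.

Lemma input_to_state_bound t : 0 <= t -> exists2 C, 0 <= C &
  forall u x, in_Lp S p t u -> input_to_state t u x ->
  rnorm S x <= C * Lp_norm S p t u.
Proof.
move=> t0.
have pick u : exists x, in_Lp S p t u -> input_to_state t u x.
  have [Lu|nLu] := pselect (in_Lp S p t u); last by exists 0.
  by have [x hx] := reach t0 Lu; exists x.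
have [Phi hPhi] := choice pick.
have [|||||||||C C0 hC] := @zabreiko R K S (R -> U) (in_Lp S p t)
  (Lp_norm S p t) (fun u => rnorm S (Phi u)).
- by have [] := in_Lp0 S p1 U t.
- by move=> u v Lu Lv; have [] := in_LpD p1 Lu Lv.
- by move=> k u Lu; have [] := in_LpZ p1 k Lu.
- by move=> u v Lu Lv; have [] := in_LpD p1 Lu Lv.
- by move=> k u Lu; have [] := in_LpZ p1 k Lu.
- move=> u v Lu Lv; have [Luv _] := in_LpD p1 Lu Lv.
  by rewrite (input_to_stateD (hPhi _ Lu) (hPhi _ Lv) (hPhi _ Luv)) rnormD.
- move=> k u Lu; have [Lku _] := in_LpZ p1 k Lu.
  by rewrite (input_to_stateZ (hPhi _ Lu) (hPhi _ Lku)) rnormZ.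
- exact: Lp_complete.
- move=> u v c Lu Lv uv vc.
  have Lsum n : in_Lp S p t (series v n).
    elim: n => [|n IH].
      have [L0 _] := in_Lp0 S p1 U t.
      by rewrite [series _ _]big_geq.
    have [Ln _] := in_LpD p1 IH (Lv n).
    rewrite seriesSr; exact: Ln.
  have Phisum n : Phi (series v n) = series (Phi \o v) n.
    elim: n => [|n IH].
      (* [Phi] is merely a choice of states, so even Phi 0 = 0 has to be proved; the weak bound
         gives it, as the input 0 has norm 0. *)
      apply: J_inj; rewrite {2}/series/= big_geq// linear0.
      apply/(rnorm_eq0 (S := S))/eqP; rewrite eq_le rnorm_ge0 andbT.
      have := input_to_state_weak_bound t0 (Lsum 0%N) (hPhi _ (Lsum 0%N)).
      rewrite {2}/series/= big_geq//.
      by have [_ ->] := in_Lp0 S p1 U t; rewrite mulr0.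
    rewrite [in RHS]seriesSr -IH.
    apply: (input_to_stateD (hPhi _ (Lsum n)) (hPhi _ (Lv n))).
    have [Ln _] := in_LpD p1 (Lsum n) (Lv n); move: (hPhi _ Ln).
    by rewrite -seriesSr.
  have /cvg_ex[x Phix] : cvgn (series (Phi \o v)).
    apply: (@cvg_series_rnorm _ _ S).
    apply: nondecreasing_is_cvgn.
      by apply/nondecreasing_seqP => n; rewrite seriesSr lerDl rnorm_ge0.
    by exists c => _ [n _ <-]; exact: vc.
  have -> : Phi u = x.
    have JPhi : J (series (Phi \o v) n) @[n --> \oo] --> J (Phi u).
      apply/(cvg_rnormP S).
      set C := M * `|MB| * (fine (leb `]0%R, t[) + 1).
      apply: (squeeze_cvgr (f := cst 0) (h := fun n => C * Lp_norm S p t (u - series v n))).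
      + apply: nearW => n; rewrite rnorm_ge0 /= rnormC -Phisum.
        have LN : in_Lp S p t (- series v n).
          by have [] := in_LpZ p1 (-1) (Lsum n); rewrite rmorphN1 scaleN1r.
        have [Lsub _] := in_LpD p1 Lu LN.
        have -> : J (Phi u) - J (Phi (series v n)) = J (Phi (u - series v n)).
          rewrite -linearB; congr (J _); apply/esym.
          rewrite (input_to_stateD (hPhi _ Lu) (hPhi _ LN) (hPhi _ Lsub)).
          have [LN' _] := in_LpZ p1 (-1) (Lsum n).
          have := input_to_stateZ (hPhi _ (Lsum n)) (hPhi _ LN').
          by rewrite rmorphN1 !scaleN1r => ->.
        exact: (input_to_state_weak_bound t0 Lsub (hPhi _ Lsub)).
      + exact: cvg_cst.
      + by rewrite -[X in _ --> X](mulr0 C); apply: cvgMr.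
    apply: J_inj.
    exact: (cvg_unique (@norm_hausdorff _ _) JPhi (bounded_op_cvg J_bounded Phix)).
  have normx : rnorm S (series (Phi \o v) n) @[n --> \oo] --> rnorm S x.
    exact: cvg_rnorm Phix.
  apply: (cvgr_to_le normx); apply: nearW => n.
  exact: le_trans (rnorm_sum _ _ _ _) (vc n).
exists C => // u x Lu hx.
by rewrite (input_to_state_unique hx (hPhi u Lu)); exact: hC.
Qed.

(** The constant 2C solves c = c/2 + C, so it survives each further interval of length tau. *)
Lemma input_to_state_uniform_bound : exists2 C, 0 <= C &
  forall t u x, 0 <= t -> in_Lp S p t u -> input_to_state t u x ->
  rnorm S x <= C * Lp_norm S p t u.
Proof.
have [tau tau0 Ttau] : exists2 tau, 0 < tau & M * expR (- (w * tau)) <= 2^-1.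
  (* For this tau the claim reads 2M <= exp(2M), which follows from 1 + x <= exp x. *)
  exists ((2 * M) / w); first by rewrite divr_gt0// mulr_gt0.
  rewrite [w * _]mulrC divfK ?gt_eqF// expRN ler_pdivrMr ?expR_gt0//.
  rewrite -ler_pdivrMl ?invr_gt0// invrK.
  by apply: le_trans (expR_ge1Dx _); rewrite lerDr.
have arith (D a b c n n1 n2 : R) : a <= 2^-1 * b -> b <= 2 * D * n1 ->
    c <= D * n2 -> D * n2 <= D * n -> D * n1 <= D * n -> a + c <= 2 * D * n.
  by lra.
have [C C0 hC] := input_to_state_bound (ltW tau0).
exists (2 * C) => [|t u x t0]; first by rewrite mulr_ge0.
have [n tn] : exists n : nat, t <= n%:R * tau.
  exists (Num.bound (t / tau)); rewrite -ler_pdivrMr// ltW//.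
  by rewrite archi_boundP// divr_ge0// ltW.
(* Induction on the number of intervals of length tau needed to cover [0, t]. *)
elim: n t u x t0 tn => [|n IH] t u x t0 tn Lu hx; have NC := Lp_norm_ge0 S p t u.
  have {tn} t_eq : t = 0 by apply/le_anti; rewrite t0 -(mul0r tau) tn.
  rewrite (_ : x = 0) ?rnorm0 ?mulr_ge0//.
  have := input_to_state_line hx; rewrite /F t_eq => h.
  apply: J_inj; rewrite linear0.
  apply/(rnorm_eq0 (S := S))/eqP; rewrite eq_le rnorm_ge0 andbT -lee_fin.
  apply: le_trans (line_integral_le h) _.
  rewrite integral0_eq// => s _; rewrite zero_extN ?rnorm0//= in_itv/=.
  by move=> /andP[/lt_trans h1 /h1]; rewrite ltxx.
have t_tau : t - tau <= n%:R * tau by move: tn; rewrite -natr1; lra.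
have [tt|tt] := leP t tau.
  (* A short input is delayed so as to end at tau. Its zero prefix leaves the state at 0, so x is
     also reached at time tau, where the bound C is known. *)
  pose v s := if s <= tau - t then 0 else u (s - (tau - t)).
  have a0 : 0 <= tau - t by rewrite subr_ge0.
  have [Lv Nv] : in_Lp S p tau v /\ Lp_norm S p tau v <= Lp_norm S p t u.
    exact: in_Lp_delay.
  have [y hy] := reach (ltW tau0) Lv.
  have a_le : tau - t <= tau by rewrite lerBlDr lerDl.
  have [Lz _] := in_Lp_restrict p1 Lv a_le.
  have [z hz] := reach a0 Lz.
  have z0 : z = 0.
    apply: J_inj; rewrite linear0.
    apply/(rnorm_eq0 (S := S))/eqP; rewrite eq_le rnorm_ge0 andbT -lee_fin.
    apply: le_trans (line_integral_le (input_to_state_line hz)) _.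
    rewrite integral0_eq// => s _; rewrite /F /zero_ext; case: ifPn; last by rewrite rnorm0.
    by rewrite inE/= in_itv/= => /andP[_ /ltW sa]; rewrite /v sa !linear0 rnorm0.
  have yx : y = T t z + x.
    apply: (@input_to_state_concat (tau - t) t v u) => //; last by rewrite subrK.
    by move=> s s0 st; rewrite /v gerDr leNgt s0 /= addrK.
  have : rnorm S y <= C * Lp_norm S p tau v by exact: hC.
  rewrite yx z0 linear0 add0r => /le_trans; apply.
  apply: le_trans (ler_wpM2l C0 Nv) _.
  by rewrite -mulrA ler_peMl ?mulr_ge0// ler1n.
have a0 : 0 <= t - tau by rewrite subr_ge0 ltW.
have [La Na] : in_Lp S p (t - tau) u /\ Lp_norm S p (t - tau) u <= Lp_norm S p t u.
  by apply: in_Lp_restrict => //; rewrite lerBlDr lerDl ltW.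
pose v s := u (s + (t - tau)).
have [Lv Nv] : in_Lp S p tau v /\ Lp_norm S p tau v <= Lp_norm S p t u.
  by apply: (in_Lp_shift p1 Lu a0) => //; rewrite subrK.
have [y hy] := reach a0 La; have [z hz] := reach (ltW tau0) Lv.
have -> : x = T tau y + z.
  by apply: (@input_to_state_concat (t - tau) tau u v) => //; [exact: ltW|rewrite subrK].
apply: le_trans (rnormD _ _ _) _.
have h1 : rnorm S (T tau y) <= 2^-1 * rnorm S y.
  by apply: le_trans (T_le _ (ltW tau0)) _; rewrite ler_wpM2r ?rnorm_ge0.
have h2 := IH _ _ _ a0 t_tau La hy; have h3 := hC _ _ Lv hz.
have h4 := ler_wpM2l C0 Nv; have h5 := ler_wpM2l C0 Na.
exact: arith h1 h2 h3 h4 h5.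
Qed.

End Admissibility.

(** * The equivalence *)

Section ComparisonFunctions.
Context {R : realType}.

Lemma class_Koo_powR (k q : R) : 0 < k -> 0 < q -> class_Koo (fun r => k * r `^ q).
Proof.
move=> k0 q0; split; first split.
- apply/continuous_within_itvcyP; split.
    move=> x; rewrite in_itv/= andbT => x0.
    have c : {for x, continuous (fun y : R => y `^ q)}.
      apply: differentiable_continuous; apply/derivable1_diffP.
      by apply: derivable_powR; rewrite in_itv/= x0.
    by apply: cvgMr; exact: c.
  rewrite powR0 ?gt_eqF//; apply: cvgMr.
  exact: powR_cvg0.
- move=> x y x0 xy; rewrite ltr_pM2l//; apply: gt0_ltr_powR => //; rewrite nnegrE//.
  by rewrite (le_trans x0)// ltW.
- by rewrite powR0 ?gt_eqF// mulr0.
- by move=> x x0; rewrite mulr_ge0 ?powR_ge0// ltW.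
- apply/cvgryPge => a; exists ((`|a| / k) `^ q^-1); split; first exact: num_real.
  move=> x /= ax; have -> : a = k * (a / k) by rewrite mulrC divfK ?gt_eqF.
  rewrite ler_pM2l//; apply: (@le_trans _ _ (`|a| / k)).
    by rewrite ler_pM2r ?invr_gt0// ler_norm.
  have -> : `|a| / k = ((`|a| / k) `^ q^-1) `^ q.
    by rewrite -powRrM mulVf ?gt_eqF// powRr1// divr_ge0// ltW.
  apply: ge0_ler_powR; rewrite ?nnegrE ?powR_ge0 ?(ltW q0) ?(ltW ax)//.
  exact: le_trans (powR_ge0 _ _) (ltW ax).
Qed.

(** The exponent 1 is kept so that the dependence on s is an instance of [class_Koo_powR]. *)
Lemma class_KL_exp (M w : R) : 0 < M -> 0 < w ->
  class_KL (fun s t => M * expR (- (w * t)) * s `^ 1).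
Proof.
move=> M0 w0; split=> [t _|s s0].
  by have [] := @class_Koo_powR (M * expR (- (w * t))) 1 (mulr_gt0 M0 (expR_gt0 _)) ltr01.
rewrite powRr1 ?(ltW s0)//; split.
- apply: continuous_subspaceT => t; apply: cvgMl; apply: cvgMr.
  apply: continuous_cvg; first exact: continuous_expR.
  by apply: cvgN; apply: cvgMr; exact: cvg_id.
- move=> x y _ xy; rewrite ltr_pM2r// ltr_pM2l// ltr_expR ltrN2.
  by rewrite ltr_pM2l.
- rewrite -(mul0r s); apply: cvgMl; rewrite -(mulr0 M); apply: cvgMr.
  apply/cvgrPdist_lt => e e0.
  have /cvgrPdist_lt/(_ e e0)[m [_ hm]] := @cvgr_expR R.
  exists (m / w); split; first exact: num_real.
  by move=> t /= mt; apply: hm; rewrite mulrC -ltr_pdivrMr.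
- by move=> t _; rewrite !mulr_ge0 ?expR_ge0// ltW.
Qed.

End ComparisonFunctions.

(** * Reduction of the three properties to admissibility and stability *)

Section MainEquivalence.
Context {R : realType} {K : numFieldType} (S : scalars R K)
  {X U Xm1 : completeNormedModType K} (A : unbounded_op X)
  (T : R -> {linear X -> X}) (J : {linear X -> Xm1})
  (Tm1 : R -> {linear Xm1 -> Xm1}) (B : {linear U -> Xm1}) (p : R).
Hypothesis hA : generates S A T.
Hypothesis hX : is_extrapolation_space S A J.
Hypothesis hT : is_extended_semigroup S J T Tm1.
Hypothesis hB : bounded_op S B.
Hypothesis p1 : 1 <= p.

Let p0 : 0 < p. Proof. exact: lt_le_trans ltr01 p1. Qed.
Let T0 : C0_semigroup S T. Proof. by have [] := hA. Qed.

Definition admissible_and_stable : Prop := exponentially_stable S T /\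
  forall t u, 0 <= t -> in_Lp S p t u -> exists x, input_to_state S J Tm1 B t u x.

Lemma mild_solution0 t u x : is_mild_solution_at S J T Tm1 B t 0 u (J x) ->
  input_to_state S J Tm1 B t u x.
Proof. by move=> [v hv]; rewrite !linear0 add0r /input_to_state => ->. Qed.

Lemma mild_solution_zero_input t x0 x :
  is_mild_solution_at S J T Tm1 B t x0 0 (J x) -> x = T t x0.
Proof.
move=> [v /(bochner_line_integral (measurable_itv _) (lebesgue_measure_oo_lty 0 t)) hv Jx].
apply: (extrapolation_injective hX); rewrite Jx.
suff -> : v = 0 by rewrite addr0.
apply/(rnorm_eq0 (S := S))/eqP; rewrite eq_le rnorm_ge0 andbT -lee_fin.
apply: le_trans (line_integral_le hv) _.
rewrite integral0_eq// => s _; rewrite /zero_ext; case: ifP; last by rewrite rnorm0.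
by rewrite !linear0 rnorm0.
Qed.

Lemma mu_integral0 (mu : R -> R) t : mu 0 = 0 -> mu_integral S mu t (0 : R -> U) = 0%E.
Proof. by move=> mu0; rewrite /mu_integral integral0_eq// => s _; rewrite rnorm0 mu0. Qed.

Lemma admissible_and_stable_bound : admissible_and_stable ->
  exists M w C : R, [/\ 0 < M, 0 < w, 0 < C &
  forall t x0 u, 0 <= t -> in_Lp S p t u ->
    exists2 x, is_mild_solution_at S J T Tm1 B t x0 u (J x) &
    rnorm S x <= M * expR (- (w * t)) * rnorm S x0 `^ 1 + C * Lp_norm S p t u].
Proof.
move=> [[M [w [M0 w0 hM]]] reach]; have [MB hMB] := hB.
have [C C0 hC] := input_to_state_uniform_bound p1 (extrapolation_injective hX)
  (extrapolation_bounded hX) hT M0 w0 hM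
  (extended_semigroup_bound hA hX hT (ltW M0) hM) hMB reach.
(* C may be 0, but the comparison functions built from it must be strictly increasing. *)
exists M, w, (C + 1); split => // [|t x0 u t0 Lu]; first by rewrite ltr_wpDl.
have [y hy] := reach t u t0 Lu; exists (T t x0 + y).
  by exists (J y) => //; rewrite linearD.
apply: le_trans (rnormD _ _ _) _; rewrite powRr1 ?rnorm_ge0//.
apply: lerD; first exact: hM.
apply: le_trans (hC _ _ _ t0 Lu hy) _.
by rewrite ler_wpM2r ?Lp_norm_ge0// lerDl.
Qed.

Lemma stable_of_zero_input (b : R -> R -> R) : class_KL b ->
  (forall t x0, 0 <= t -> exists2 x, is_mild_solution_at S J T Tm1 B t x0 0 (J x) &
    rnorm S x <= b (rnorm S x0) t) -> exponentially_stable S T.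
Proof.
move=> bKL hb; apply: (exponentially_stable_KL T0 bKL) => t x0 t0.
by have [x /mild_solution_zero_input -> ] := hb t x0 t0.
Qed.

Lemma Lp_ISS_admissible : Lp_ISS S J T Tm1 B p <-> admissible_and_stable.
Proof.
split=> [[b [mu [bKL [[_ _ mu0 _] _] h]]]|/admissible_and_stable_bound].
  split=> [|t u t0 Lu]; last first.
    by have [x /mild_solution0 hx _] := h t 0 u t0 Lu; exists x.
  apply: (stable_of_zero_input bKL) => t x0 t0.
  have [L0 N0] := in_Lp0 S p1 U t; have [x hx] := h t x0 _ t0 L0.
  by rewrite N0 mu0 addr0; exists x.
move=> [M [w [C [M0 w0 C0 h]]]].
exists (fun s t => M * expR (- (w * t)) * s `^ 1), (fun r => C * r `^ 1).
split; [exact: class_KL_exp|exact: class_Koo_powR|move=> t x0 u t0 Lu].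
have [x hx xle] := h t x0 u t0 Lu; exists x => //.
by rewrite [Lp_norm _ _ _ _ `^ 1]powRr1 ?Lp_norm_ge0.
Qed.

Lemma Lp_iISS_admissible : Lp_iISS S J T Tm1 B p <-> admissible_and_stable.
Proof.
split=> [[b [theta [mu [bKL [[_ _ th0 _] _] [_ _ mu0 _] h]]]]|/admissible_and_stable_bound].
  split=> [|t u t0 Lu]; last first.
    by have [x /mild_solution0 hx _] := h t 0 u t0 Lu; exists x.
  apply: (stable_of_zero_input bKL) => t x0 t0.
  have [L0 N0] := in_Lp0 S p1 U t; have [x hx] := h t x0 _ t0 L0.
  by rewrite mu_integral0//= th0 addr0 ltry => /(_ isT); exists x.
move=> [M [w [C [M0 w0 C0 h]]]].
(* With these choices theta of the mu-integral unfolds to C times [Lp_norm]. *)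
exists (fun s t => M * expR (- (w * t)) * s `^ 1), (fun r => C * r `^ p^-1),
  (fun r => 1 * r `^ p).
split.
- exact: class_KL_exp.
- by apply: class_Koo_powR => //; rewrite invr_gt0.
- by have [] := class_Koo_powR (ltr01 : 0 < 1 :> R) p0.
move=> t x0 u t0 Lu; have [x hx xle] := h t x0 u t0 Lu.
exists x; [exact: hx|move=> _].
rewrite /mu_integral; under eq_integral do rewrite mul1r.
exact: xle.
Qed.

Lemma Lp_UBEBS_admissible :
  Lp_UBEBS S J T Tm1 B p /\ exponentially_stable S T <-> admissible_and_stable.
Proof.
split=> [[[gamma [theta [mu [c [_ _ _ h]]]]] st]|adm].
  split=> // t u t0 Lu.
  by have [x /mild_solution0 hx _] := h t 0 u t0 Lu; exists x.
split; last by have [] := adm.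
have [M [w [C [M0 w0 C0 h]]]] := admissible_and_stable_bound adm.
(* gamma results from bounding the decay factor by 1; the offset only has to be positive. *)
exists (fun s => M * s `^ 1), (fun r => C * r `^ p^-1), (fun r => 1 * r `^ p), 1.
split => //.
- by split; apply: class_Koo_powR => //; rewrite invr_gt0.
- by have [] := class_Koo_powR (ltr01 : 0 < 1 :> R) p0.
move=> t x0 u t0 Lu; have [x hx xle] := h t x0 u t0 Lu.
exists x; [exact: hx|move=> _].
rewrite /mu_integral; under eq_integral do rewrite mul1r.
apply: le_trans xle _; rewrite -addrA; apply: lerD; last by rewrite lerDl.
rewrite ler_wpM2r ?powR_ge0// ler_piMr ?(ltW M0)//.
by rewrite -expR0 ler_expR oppr_le0 mulr_ge0// ltW.
Qed.

End MainEquivalence.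

Theorem proposition2p10 (R : realType) (K : numFieldType) (S : scalars R K)
    (X U Xm1 : completeNormedModType K)
    (A : unbounded_op X) (T : R -> {linear X -> X})
    (J : {linear X -> Xm1}) (Tm1 : R -> {linear Xm1 -> Xm1})
    (B : {linear U -> Xm1}) (p : R)
    (hA : generates S A T)
    (hX : is_extrapolation_space S A J)
    (hT : is_extended_semigroup S J T Tm1)
    (hB : bounded_op S B)
    (hp : 1 <= p) :
  (Lp_ISS S J T Tm1 B p <-> Lp_iISS S J T Tm1 B p) /\
  (Lp_iISS S J T Tm1 B p <->
     Lp_UBEBS S J T Tm1 B p /\ exponentially_stable S T).
Proof.
have ISS := Lp_ISS_admissible hA hX hT hB hp.
have iISS := Lp_iISS_admissible hA hX hT hB hp.
have UBEBS := Lp_UBEBS_admissible hA hX hT hB hp.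
by split; [rewrite ISS iISS|rewrite iISS UBEBS].
Qed.
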